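(* Let $\gamma,\delta\in (0,1)$ be such that $$\gamma < \frac{\delta}{2(1-\gamma)}e^{- \frac{1}{1- \gamma}}- \frac{\delta^{3/2}}{6(1-\gamma)^2}e^{- \frac{7}{8(1-\gamma)}}.$$ Then there is an integer $R$ such that for all $r\geq R$ the following holds: every graph $G$ with maximum degree at most $r$ in which, for every vertex $v$, the neighborhood $N(v)$ induces a graph with at most $(1-\delta)\binom{r}{2}$ edges satisfies $$\chi(G)\leq (1-\gamma) r .$$
   Context: All graphs are finite and simple. $N(v)$ is the set of neighbors of $v$, and $\chi(G)$ is the (vertex) chromatic number of $G$. *)

(* Defs.v *)
From mathcomp Require Import all_boot.

Set Implicit Arguments.
Unset Strict Implicit.
Unset Printing Implicit Defensive.

Record sgraph := SGraph {
  vertex :> finType;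
  adj : rel vertex;
  adj_sym : symmetric adj;
  adj_irrefl : irreflexive adj }.

Definition neighbors (G : sgraph) (v : G) : {set G} := [set w | adj v w].

Definition max_degree (G : sgraph) : nat := \max_(v : G) #|neighbors v|.

Definition edges (G : sgraph) : {set {set G}} :=
  [set E : {set G} |
    [exists x : G, exists y : G, adj x y && (E == [set x; y])]].

Section Induced.
Variables (G : sgraph) (A : {set G}).

Definition induced_adj : rel {x : G | x \in A} :=
  fun x y => adj (val x) (val y).

Lemma induced_adj_sym : symmetric induced_adj.
Proof. by move=> x y; apply: adj_sym. Qed.

Lemma induced_adj_irrefl : irreflexive induced_adj.
Proof. by move=> x; apply: adj_irrefl. Qed.

Definition induced_subgraph : sgraph := SGraph induced_adj_sym induced_adj_irrefl.
End Induced.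

Definition proper_coloring (G : sgraph) (k : nat) (c : {ffun G -> 'I_k}) : bool :=
  [forall x : G, forall y : G, adj x y ==> (c x != c y)].

Definition colorable (G : sgraph) (k : nat) : bool :=
  [exists c : {ffun G -> 'I_k}, proper_coloring c].

Lemma colorable_exists (G : sgraph) : exists k, colorable G k.
Proof.
exists #|G|; apply/existsP; exists [ffun x => enum_rank x].
apply/forallP => x; apply/forallP => y; apply/implyP => xy.
rewrite !ffunE; apply/eqP => /enum_rank_inj eq_xy.
by move: xy; rewrite eq_xy adj_irrefl.
Qed.

Definition chromatic_number (G : sgraph) : nat := ex_minn (colorable_exists G).

(* Main.v *)
(** Write C = floor((1 - gamma) r).  Colour every vertex with one of C colours  *)
(** uniformly at random; in each monochromatic edge a fair coin decides which   *)
(** end loses its colour.  The result is a proper partial colouring, and it     *)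
(** extends greedily to a C-colouring as soon as, in every neighbourhood N(v),  *)
(** repeated colours save more than r - C colours.  If the colour a survives k  *)
(** times in N(v), it saves k - 1 >= C(k,2) - C(k,3) colours, so the expected   *)
(** saving is at least the expected number of surviving monochromatic           *)
(** nonadjacent pairs minus that of independent triples: this is the bound in   *)
(** the hypothesis, once the graph has been made r-regular and the number of    *)
(** triangles in a graph with m edges has been bounded by (2m)^(3/2) / 6.       *)
(** The saving at v is concentrated by a Bernstein inequality for functions of  *)
(** independent variables: a label at distance two matters only if its colour   *)
(** appears among its neighbours in N(v), so that although there are r^2        *)
(** labels, the sum of the conditional variances is O(r).  The symmetric local  *)
(** lemma then makes all savings large simultaneously.                          *)

Require Import Defs.
From HB Require Import structures.
From mathcomp Require Import all_boot all_order all_algebra.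
From mathcomp Require Import all_classical all_reals all_analysis.
From mathcomp Require Import ring lra zify.

Set Implicit Arguments.
Unset Strict Implicit.
Unset Printing Implicit Defensive.

Import Order.TTheory GRing.Theory Num.Theory.

Local Open Scope ring_scope.

(** * Averages over finite sets and product spaces *)

(** In quantities: let [t] = 1/(1 - gamma) and [s] = sqrt(delta), so that r/C is close to [t]. A
    nonadjacent pair survives in a given common colour with probability at least about C^-2 e^(-t)
    ([pr_all_kept_ge]), an independent triple with probability at most about C^-3 e^(-7t/8)
    ([pr_all_kept_le]). There are at least about s^2 r^2 ordered nonadjacent pairs in a
    neighbourhood, and [ntriples_npairs] bounds the triples by the pairs, so [mean_saved_asymptotic]
    gives an expected saving of at least r (a s^2 - b s^3) - 8 with a = t e^(-t) / 2 and b = t^2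
    e^(-7t/8) / 6.

    The hypothesis says that a s^2 - b s^3 exceeds gamma by some eps > 0, while r - C is gamma r up
    to rounding; the slack eps r is linear. By [mgf_le] and [small_var_saved] too small a saving has
    probability exponentially small in r, whereas each such event shares labels with only O(r^4)
    others, so [local_lemma] applies once r is large. *)

Section Mean.
Variable R : realType.
Implicit Types A B : finType.

Definition mean A (f : A -> R) : R := (\sum_a f a) / #|A|%:R.

Lemma eq_mean A (f g : A -> R) : (forall a, f a = g a) -> mean f = mean g.
Proof. by move=> fg; congr (_ / _); apply: eq_bigr => a _. Qed.

Lemma meanD A (f g : A -> R) : mean (fun a => f a + g a) = mean f + mean g.
Proof. by rewrite /mean big_split mulrDl. Qed.

Lemma meanZ A (k : R) (f : A -> R) : mean (fun a => k * f a) = k * mean f.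
Proof. by rewrite /mean -mulr_sumr mulrA. Qed.

Lemma meanN A (f : A -> R) : mean (fun a => - f a) = - mean f.
Proof. by rewrite /mean sumrN mulNr. Qed.

Lemma meanB A (f g : A -> R) : mean (fun a => f a - g a) = mean f - mean g.
Proof. by rewrite meanD meanN. Qed.

Lemma mean_sum A (I : Type) (s : seq I) (P : pred I) (f : I -> A -> R) :
  mean (fun a => \sum_(i <- s | P i) f i a) = \sum_(i <- s | P i) mean (f i).
Proof. by rewrite /mean exchange_big mulr_suml. Qed.

Lemma le_mean A (f g : A -> R) : (forall a, f a <= g a) -> mean f <= mean g.
Proof. by move=> fg; rewrite ler_wpM2r ?invr_ge0// ler_sum. Qed.

Lemma mean_cst A (k : R) : (0 < #|A|)%N -> mean (fun _ : A => k) = k.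
Proof.
move=> A0; rewrite /mean sumr_const -[k *+ _]mulr_natr mulfK//.
by rewrite pnatr_eq0 -lt0n.
Qed.

Lemma mean_const A (f : A -> R) (k : R) :
  (0 < #|A|)%N -> (forall a, f a = k) -> mean f = k.
Proof. by move=> A0 /eq_mean ->; exact: mean_cst. Qed.

Lemma mean_ge0 A (f : A -> R) : (forall a, 0 <= f a) -> 0 <= mean f.
Proof. by move=> f0; rewrite divr_ge0// sumr_ge0. Qed.

Lemma mean_exchange A B (f : A -> B -> R) :
  mean (fun a => mean (f a)) = mean (fun b => mean (f^~ b)).
Proof. by rewrite /mean -!mulr_suml exchange_big /= mulrAC. Qed.

Lemma mean_pair A B (f : A * B -> R) :
  mean f = mean (fun a => mean (fun b => f (a, b))).
Proof.
rewrite /mean -mulr_suml pair_bigA /= card_prod natrM invfM mulrA mulrAC.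
by congr (_ / _ / _); apply: eq_bigr => -[].
Qed.

Lemma sqr_mean_le A (f : A -> R) : (0 < #|A|)%N ->
  mean f ^+ 2 <= mean (fun a => f a ^+ 2).
Proof.
move=> A0; rewrite -subr_ge0.
have -> : mean (fun a => f a ^+ 2) - mean f ^+ 2
    = mean (fun a => (f a - mean f) ^+ 2).
  have -> : mean (fun a => (f a - mean f) ^+ 2)
      = mean (fun a => (f a ^+ 2 + (- 2 * mean f) * f a) + mean f ^+ 2).
    by apply: eq_mean => a; ring.
  by rewrite !meanD meanZ mean_cst//; ring.
by apply: mean_ge0 => a; apply: sqr_ge0.
Qed.

Lemma mean_norm_le A (f : A -> R) (c : R) : (0 < #|A|)%N ->
  (forall a, `|f a| <= c) -> `|mean f| <= c.
Proof.
move=> A0 fc; rewrite /mean normrM [`|_^-1|]ger0_norm ?invr_ge0//.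
rewrite -[leRHS](mean_cst c A0) /mean ler_wpM2r ?invr_ge0//.
by rewrite (le_trans (ler_norm_sum _ _ _))// ler_sum.
Qed.

Lemma mean_var_le A (f : A -> R) (k : R) : (0 < #|A|)%N ->
  mean (fun a => (f a - mean f) ^+ 2) <= mean (fun a => (f a - k) ^+ 2).
Proof.
move=> A0.
have E c : mean (fun a => (f a - c) ^+ 2)
    = mean (fun a => f a ^+ 2) - 2 * c * mean f + c ^+ 2.
  have -> : mean (fun a => (f a - c) ^+ 2)
      = mean (fun a => (f a ^+ 2 + (- 2 * c) * f a) + c ^+ 2).
    by apply: eq_mean => a; ring.
  by rewrite !meanD meanZ mean_cst//; ring.
rewrite !E -subr_ge0.
have -> : mean (fun a => f a ^+ 2) - 2 * k * mean f + k ^+ 2 -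
   (mean (fun a => f a ^+ 2) - 2 * mean f * mean f + mean f ^+ 2)
   = (mean f - k) ^+ 2 by ring.
exact: sqr_ge0.
Qed.

Lemma mean_ffun_prod (I T : finType) (F : I -> T -> R) :
  mean (fun w : {ffun I -> T} => \prod_i F i (w i)) = \prod_i mean (F i).
Proof.
rewrite /mean card_ffun -bigA_distr_bigA /= natrX.
by rewrite big_split /= prodr_const exprVn.
Qed.

End Mean.

Section Product.
Variables (R : realType) (I T : finType).
Hypothesis T0 : (0 < #|T|)%N.
Local Notation Omega := {ffun I -> T}.
Implicit Types (S : {set I}) (w : Omega) (f g : Omega -> R).

Lemma card_Omega : (0 < #|Omega|)%N.
Proof. by rewrite card_ffun expn_gt0 T0. Qed.
Hint Resolve card_Omega : core.

Lemma mean_coord (i : I) (h : T -> R) :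
  mean (fun w : Omega => h (w i)) = mean h.
Proof.
have := @mean_ffun_prod R I T (fun j => if j == i then h else fun=> 1).
rewrite (bigD1 i)//= eqxx [X in _ * X]big1 ?mulr1; last first.
  by move=> j /negPf ->; rewrite mean_cst.
move=> <-; apply: eq_mean => w; rewrite (bigD1 i)//= eqxx big1 ?mulr1//.
by move=> j /negPf ->.
Qed.

Definition mix S w1 w2 : Omega := [ffun i => if i \in S then w1 i else w2 i].

Definition depends_on (X : Type) S (f : Omega -> X) :=
  forall w1 w2, {in S, w1 =1 w2} -> f w1 = f w2.

(* The conditional expectation given the coordinates outside [S]. *)
Definition mean_on S f w := mean (fun w1 => f (mix S w1 w)).

Lemma mean_mean_on S f : mean (mean_on S f) = mean f.
Proof.
rewrite /mean_on mean_exchange -(mean_pair (fun p => f (mix S p.1 p.2))).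
rewrite -[RHS](mean_cst (mean f) card_Omega) mean_exchange.
rewrite -(mean_pair (fun p => f p.1)) /mean; congr (_ / _).
(* Exchanging the coordinates in [S] between two independent samples is an involution on pairs, so
   the mixed sample is again uniform. *)
pose h (p : Omega * Omega) := (mix S p.1 p.2, mix S p.2 p.1).
have hK : involutive h.
  by move=> [a b]; rewrite /h /=; congr (_, _); apply/ffunP => i; rewrite !ffunE; case: (_ \in _).
by rewrite [RHS](reindex_inj (inv_inj hK)).
Qed.

Lemma mean_on_depends S f w : depends_on S f -> mean_on S f w = mean f.
Proof.
by move=> fS; apply: eq_mean => w1; apply: fS => i iS; rewrite ffunE iS.
Qed.

(** Averaging over the coordinates in [S1] alone replaces [f] by its mean and leaves [g]
    untouched. *)
Lemma mean_indep S1 S2 f g : depends_on S1 f -> depends_on S2 g ->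
  [disjoint S1 & S2] -> mean (fun w => f w * g w) = mean f * mean g.
Proof.
move=> fS gS dS; rewrite -(mean_mean_on S1).
rewrite -meanZ; apply: eq_mean => w.
rewrite -(mean_on_depends w fS) [RHS]mulrC -meanZ; apply: eq_mean => w1.
rewrite mulrC; congr (_ * _); apply: gS => i iS; rewrite ffunE.
by rewrite (disjointFl dS iS).
Qed.

Lemma mean_on_comm S1 S2 f w : [disjoint S1 & S2] ->
  mean_on S1 (mean_on S2 f) w = mean_on S2 (mean_on S1 f) w.
Proof.
move=> dS; rewrite /mean_on mean_exchange; apply: eq_mean => w2.
apply: eq_mean => w1; congr f; apply/ffunP => i; rewrite !ffunE.
case: ifP => // i2; by rewrite (disjointFl dS i2).
Qed.

Lemma depends_on_mean_on i S f :
  depends_on (i |: S) f -> depends_on S (mean_on [set i] f).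
Proof.
move=> fS w1 w2 ww; apply: eq_mean => w3; apply: fS => j.
rewrite !inE !ffunE inE; case: eqP => //= _; exact: ww.
Qed.

(** * Bernstein-type bound on the moment generating function *)

Section Bernstein.
Variables (c : R) (v : I -> R).

Definition dev i f w := f w - mean_on [set i] f w.

Definition small_var i f := forall w,
  `|dev i f w| <= c /\ mean_on [set i] (fun w1 => dev i f w1 ^+ 2) w <= v i.

(** Averaging over another coordinate commutes with [dev i], and by Jensen it increases neither
    bound. Hence bounds checked on the original function pass to all its martingale differences. *)
Lemma small_var_mean_on i j f : i != j ->
  small_var i f -> small_var i (mean_on [set j] f).
Proof.
move=> ij fi w.
have dij : [disjoint [set i] & [set j]].
  by rewrite disjoints1 inE.
have devE w1 : dev i (mean_on [set j] f) w1 = mean_on [set j] (dev i f) w1.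
  by rewrite /dev mean_on_comm// /mean_on meanB.
split.
  by rewrite devE mean_norm_le// => w1; case: (fi (mix [set j] w1 w)).
apply: (@le_trans _ _ (mean_on [set i]
          (mean_on [set j] (fun w1 => dev i f w1 ^+ 2)) w)).
  by apply: le_mean => w1; rewrite devE sqr_mean_le.
rewrite mean_on_comm// -[leRHS](@mean_cst R Omega)//.
by apply: le_mean => w1; case: (fi (mix [set j] w1 w)).
Qed.

(** From e^x <= 1/(1 - x), since (1 + x + 2x^2)(1 - x) = 1 + x^2 (1 - 2x). *)
Lemma expR_le_quadratic (x : R) : x <= 1 / 2 -> expR x <= 1 + x + 2 * x ^+ 2.
Proof.
move=> x2.
have x1 : 0 < 1 - x by lra.
have : expR x <= (1 - x)^-1.
  rewrite -[leLHS]invrK -expRN lef_pV2 ?posrE ?expR_gt0//.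
  by rewrite (le_trans _ (expR_ge1Dx _)).
move=> /le_trans; apply; rewrite -[leLHS]mul1r ler_pdivrMr//.
nra.
Qed.

(** The deviation has conditional mean zero, so only the quadratic term of the expansion survives,
    and it is a conditional variance. *)
Lemma mean_on_expR i f (l : R) w : `|l| * c <= 1 / 2 -> small_var i f ->
  mean_on [set i] (fun w1 => expR (l * f w1)) w <=
  expR (l * mean_on [set i] f w + 2 * l ^+ 2 * v i).
Proof.
move=> lc fi.
have mm w1 : mean_on [set i] f (mix [set i] w1 w) = mean_on [set i] f w.
  apply: eq_mean => w2; congr f; apply/ffunP => j; rewrite !ffunE.
  by case: (_ \in _).
pose D w1 := dev i f (mix [set i] w1 w).
have DE w1 : f (mix [set i] w1 w) = mean_on [set i] f w + D w1.
  by rewrite /D /dev mm; ring.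
rewrite expRD {1}/mean_on.
under eq_mean => w1 do rewrite DE mulrDr expRD.
rewrite meanZ ler_pM2l ?expR_gt0//.
apply: (@le_trans _ _ (mean (fun w1 => (1 + l * D w1) + 2 * l ^+ 2 * D w1 ^+ 2))).
  apply: le_mean => w1.
  rewrite -[2 * _ * _]mulrA -exprMn; apply: expR_le_quadratic.
  rewrite (le_trans (ler_norm _))// normrM (le_trans _ lc)// ler_wpM2l//.
  by case: (fi (mix [set i] w1 w)).
have mD : mean D = 0.
  have : mean (fun w1 => f (mix [set i] w1 w)) = mean_on [set i] f w by [].
  under eq_mean => w1 do rewrite DE.
  by rewrite meanD mean_cst//; lra.
rewrite !meanD !meanZ mD mulr0 addr0 mean_cst//.
rewrite (le_trans _ (expR_ge1Dx _))// lerD2l ler_wpM2l//.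
  by rewrite mulr_ge0// sqr_ge0.
by case: (fi w).
Qed.

(** Coordinates are integrated out one at a time: removing [i] costs a factor exp(2 l^2 [v i]) and
    leaves [mean_on [set i] f], to which induction applies. *)
Lemma mgf_le (s : seq I) f (l : R) : `|l| * c <= 1 / 2 -> uniq s ->
  depends_on [set i in s] f -> (forall i, i \in s -> small_var i f) ->
  mean (fun w => expR (l * f w)) <=
  expR (l * mean f + 2 * l ^+ 2 * \sum_(i <- s) v i).
Proof.
move=> lc; elim: s f => [|i s IH] f /=.
  move=> _ fS _; rewrite big_nil mulr0 addr0.
  have w0 : Omega by exact: (enum_val (Ordinal card_Omega)).
  have fE w : f w = mean f.
    rewrite -[LHS](mean_cst _ card_Omega); apply: eq_mean => w1.
    by apply: fS => j; rewrite inE.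
  by under eq_mean => w do rewrite fE; rewrite mean_cst.
move=> /andP[is_ us] fS fv.
have fi : small_var i f by apply: fv; rewrite inE eqxx.
rewrite -(mean_mean_on [set i]) -(mean_mean_on [set i] f) big_cons.
apply: (@le_trans _ _ (mean (fun w => expR (2 * l ^+ 2 * v i) *
           expR (l * mean_on [set i] f w)))).
  apply: le_mean => w; rewrite mulrC -expRD; exact: mean_on_expR.
rewrite meanZ mulrDr addrCA expRD ler_pM2l ?expR_gt0//.
apply: IH => //.
  apply: depends_on_mean_on => w1 w2 ww; apply: fS => j; rewrite inE => js.
  by apply: ww; rewrite !inE in js *.
move=> j js; apply: small_var_mean_on; last by apply: fv; rewrite inE js orbT.
by apply: contraNneq is_ => <-.
Qed.

End Bernstein.
End Product.

(** * The symmetric local lemma *)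

Section LocalLemma.
Variables (R : realType) (I T J : finType).
Hypothesis T0 : (0 < #|T|)%N.
Local Notation Omega := {ffun I -> T}.
Variables (A : J -> Omega -> bool) (S : J -> {set I}).
Hypothesis AS : forall j, depends_on (S j) (A j).

Definition pr (E : Omega -> bool) : R := mean (fun w => (E w)%:R).

Definition avoids (Q : {set J}) w := [forall j in Q, ~~ A j w].

Definition scope (Q : {set J}) : {set I} := \bigcup_(j in Q) S j.

Lemma depends_on_avoids Q : depends_on (scope Q) (avoids Q).
Proof.
move=> w1 w2 ww; apply: eq_forallb_in => j jQ; congr (~~ _).
by apply: AS => i ij; apply: ww; apply/bigcupP; exists j.
Qed.

Variables (p : R) (d : nat).
Hypothesis pA : forall j, pr (A j) <= p.

Definition near j := [set k | ~~ [disjoint S j & S k]].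

Hypothesis near_le : forall j, (#|near j| <= d)%N.
Hypothesis pd : 4 * p * d%:R <= 1.

Lemma pr_ge0 E : 0 <= pr E.
Proof. exact: mean_ge0. Qed.

Lemma pr_indep_le Q j :
  pr (fun w => A j w && avoids (Q :\: near j) w) <= p * pr (avoids (Q :\: near j)).
Proof.
have dj : [disjoint S j & scope (Q :\: near j)].
  by apply/bigcup_disjointP => k; rewrite !inE negbK => /andP[].
apply: le_trans (ler_wpM2r (pr_ge0 _) (pA j)).
rewrite /pr -(mean_indep T0 _ _ dj).
- by apply: le_mean => w; rewrite -natrM mulnb.
- by move=> w1 w2 ww; congr (_%:R); rewrite (AS ww).
- by move=> w1 w2 ww; congr (_%:R); rewrite (depends_on_avoids ww).
Qed.

(** This is the conditional bound P(A_j | no event of [Q]) <= 2p, multiplied out so that it makes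
    sense before the condition is known to have positive probability. *)
Lemma pr_cond_le n (Q : {set J}) j : (#|Q| <= n)%N ->
  pr (fun w => A j w && avoids Q w) <= 2 * p * pr (avoids Q).
Proof.
have p0 : 0 <= p by apply: le_trans (pA j); apply: mean_ge0.
elim: n Q j => [|n IH] Q j Qn; have ind := pr_indep_le Q j;
  have pQ0 := mulr_ge0 p0 (pr_ge0 (avoids Q)).
  move: Qn; rewrite leqn0 cards_eq0 => /eqP Q0; move: ind pQ0.
  rewrite Q0 finset.set0D; lra.
have [Qd|Qd] := eqVneq (Q :\: near j) Q; first by move: ind; rewrite Qd; lra.
have Q2n : (#|Q :\: near j| <= n)%N.
  rewrite -ltnS (leq_trans _ Qn)// proper_card// finset.properEneq Qd.
  exact: finset.subsetDl.
set Q2 := Q :\: near j in ind Q2n *.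
(* Restoring the discarded events loses at most half the probability: by induction each has
   conditional probability at most 2p, and there are at most [d] of them with 2pd <= 1/2. *)
have half : pr (avoids Q2) <= 2 * pr (avoids Q).
  suff : pr (avoids Q2) <= pr (avoids Q) + 1 / 2 * pr (avoids Q2) by lra.
  have -> : pr (avoids Q) + 1 / 2 * pr (avoids Q2) =
    mean (fun w => (avoids Q w)%:R + 1 / 2 * (avoids Q2 w)%:R) :> R.
    by rewrite meanD meanZ.
  apply: (@le_trans _ _ (mean (fun w => (avoids Q w)%:R +
     \sum_(k in Q :&: near j) (A k w && avoids Q2 w)%:R))).
    apply: le_mean => w; have [aQ|aQ] := boolP (avoids Q w).
      by rewrite ler_wpDr ?sumr_ge0// lern1 leq_b1.
    rewrite add0r; have [aQ2|_] := boolP (avoids Q2 w); last by rewrite sumr_ge0.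
    move: aQ; rewrite negb_forall_in => /exists_inP[k kQ]; rewrite negbK => Ak.
    have kn : k \in near j.
      apply: contraTT Ak => kn; move/forall_inP: aQ2; apply.
      by rewrite inE kn kQ.
    rewrite (bigD1 k) /=; last by rewrite inE kQ kn.
    by rewrite Ak lerDl sumr_ge0.
  rewrite !meanD lerD2l mean_sum meanZ.
  apply: (@le_trans _ _ (\sum_(k in Q :&: near j) 2 * p * pr (avoids Q2))).
    by apply: ler_sum => k _; exact: IH.
  rewrite sumr_const -[_ *+ _]mulr_natr mulrAC ler_wpM2r ?pr_ge0//.
  set m := #|_|.
  have md : (m <= d)%N.
    by rewrite (leq_trans _ (near_le j))// subset_leq_card// finset.subsetIr.
  have : p * m%:R <= p * d%:R by rewrite ler_wpM2l// ler_nat.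
  by move: m%:R (d%:R) pd => x y; lra.
have : pr (fun w => A j w && avoids Q w) <= pr (fun w => A j w && avoids Q2 w).
  apply: le_mean => w; rewrite ler_nat; case: (A j w) => //=.
  have [/forall_inP aQ|//] := boolP (avoids Q w).
  rewrite lt0b; apply/forall_inP => k; rewrite inE => /andP[_]; exact: aQ.
have := ler_wpM2l p0 half; lra.
Qed.

Lemma local_lemma : (0 < d)%N -> exists w, forall j, ~~ A j w.
Proof.
move=> d0.
have pos (s : seq J) : 0 < pr (avoids [set j in s]).
  elim: s => [|j s IH].
    have -> : pr (avoids [set j in [::]]) = mean (fun _ : Omega => 1).
      apply: eq_mean => w; suff -> : avoids [set j in [::]] w by [].
      by apply/forall_inP => k; rewrite inE.
    by rewrite mean_cst// card_Omega.
  (* Each further event then removes at most the fraction 2p <= 1/2 of the remaining probability.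
     Here [d] must be positive. *)
  have p4 : 4 * p <= 1.
    have [p0|p0] := ltP p 0; first by lra.
    by apply: le_trans pd; rewrite ler_peMr ?mulr_ge0// ler1n.
  have := pr_cond_le j (leqnn #|[set k in s]|).
  have -> : pr (avoids [set k in j :: s]) =
     pr (avoids [set k in s]) - pr (fun w => A j w && avoids [set k in s] w).
    rewrite /pr -meanB; apply: eq_mean => w.
    have -> : avoids [set k in j :: s] w = ~~ A j w && avoids [set k in s] w.
      apply/forall_inP/andP => [aw|[aj /forall_inP aw] k].
        split; first by apply: aw; rewrite !inE eqxx.
        by apply/forall_inP => k; rewrite inE => ks; apply: aw; rewrite !inE ks orbT.
      by rewrite !inE => /predU1P[->//|ks]; apply: aw; rewrite inE.
    by case: (A j w); case: (avoids _ w); rewrite /= ?subr0 ?subrr.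
  by nra.
have [/existsP[w /forallP Aw]|] := boolP [exists w, [forall j, ~~ A j w]].
  by exists w.
rewrite negb_exists => /forallP none.
suff E : pr (avoids [set j in enum J]) = mean (fun _ : Omega => 0).
  by have := pos (enum J); rewrite E mean_cst ?card_Omega// ltxx.
apply: eq_mean => w; have [/forall_inP aw|//] := boolP (avoids _ w).
by have /negP[] := none w; apply/forallP => j; apply: aw; rewrite inE mem_enum.
Qed.

End LocalLemma.

(** * Graphs: triangle counting, regularization, greedy colouring *)

Section CauchySchwarz.
Variable R : realType.

Lemma cauchy_schwarz (I : finType) (f g : I -> R) :
  (\sum_i f i * g i) ^+ 2 <= (\sum_i f i ^+ 2) * (\sum_i g i ^+ 2).
Proof.
have E : \sum_i \sum_j (f i * g j - f j * g i) ^+ 2 =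
   2 * ((\sum_i f i ^+ 2) * (\sum_i g i ^+ 2) - (\sum_i f i * g i) ^+ 2).
  have sw : \sum_i \sum_j f i ^+ 2 * g j ^+ 2 = \sum_i \sum_j f j ^+ 2 * g i ^+ 2.
    by rewrite exchange_big.
  rewrite [(\sum_i f i * g i) ^+ 2]expr2 !big_distrlr /= mulrBr [2 * _]mulr_natl mulr2n.
  rewrite {2}sw mulr_sumr -big_split -sumrB /=.
  apply: eq_bigr => i _; rewrite mulr_sumr -big_split -sumrB /=.
  by apply: eq_bigr => j _; ring.
have : 0 <= \sum_i \sum_j (f i * g j - f j * g i) ^+ 2.
  by apply: sumr_ge0 => i _; apply: sumr_ge0 => j _; exact: sqr_ge0.
by rewrite E; lra.
Qed.

(** In matrix terms, tr(A^3) <= |A| |A^2| <= |A|^3 for the Frobenius norm: Cauchy-Schwarz over pairs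
    (x, y), then inside each entry of A^2. *)
Lemma triangle_count_le (I : finType) (a : I -> I -> R) :
  (\sum_x \sum_y a x y * (\sum_z a y z * a z x)) ^+ 2 <=
  (\sum_x \sum_y a x y ^+ 2) ^+ 3.
Proof.
pose N : R := \sum_x \sum_y a x y ^+ 2.
rewrite (pair_bigA _ (fun x y => a x y * (\sum_z a y z * a z x))) /=.
rewrite (le_trans (@cauchy_schwarz (I * I)%type (fun p => a p.1 p.2)
  (fun p => \sum_z a p.2 z * a z p.1)))// -(pair_bigA _ (fun x y => a x y ^+ 2)).
rewrite /= -/N exprS ler_wpM2l ?sumr_ge0// => [x _|].
  by apply: sumr_ge0 => y _; exact: sqr_ge0.
rewrite -(pair_bigA _ (fun x y => (\sum_z a y z * a z x) ^+ 2)) /=.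
apply: (@le_trans _ _ (\sum_x \sum_y
    (\sum_z a y z ^+ 2) * (\sum_z a z x ^+ 2))).
  by do 2!apply: ler_sum => ? _; exact: cauchy_schwarz.
by rewrite exchange_big -big_distrlr /= expr2 {2}/N [\sum_x \sum_y a y x ^+ 2]exchange_big.
Qed.
End CauchySchwarz.

Section Graphs.
Implicit Type G : sgraph.

Lemma degE G (v : G) : #|neighbors v| = (\sum_w adj v w)%N.
Proof.
rewrite -sum1_card big_mkcond; apply: eq_bigr => w _; rewrite inE.
by case: adj.
Qed.

(** Ordered pairs are counted, so this is twice the number of edges inside the neighbourhood. *)
Definition link G (v : G) : nat :=
  \sum_x \sum_y [&& adj v x, adj v y & adj x y].

Section Double.
Variables (G : sgraph) (k : nat).

(** Two copies of [G], with the twins of each vertex of degree at most [k] joined. Such degrees grow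
    by one, the others stay. *)
Definition double_adj : rel (G * bool)%type := fun x y =>
  if x.2 == y.2 then adj x.1 y.1 else (x.1 == y.1) && (#|neighbors x.1| <= k)%N.

Lemma double_adj_sym : symmetric double_adj.
Proof.
move=> [x b] [y c]; rewrite /double_adj /= [c == b]eq_sym adj_sym.
by case: eqP => // _; rewrite eq_sym; case: eqP => // ->.
Qed.

Lemma double_adj_irrefl : irreflexive double_adj.
Proof. by move=> [x b]; rewrite /double_adj /= eqxx adj_irrefl. Qed.

Definition double := SGraph double_adj_sym double_adj_irrefl.

Lemma sum_double (F : G * bool -> nat) (b : bool) :
  (\sum_p F p = \sum_w F (w, b) + \sum_w F (w, ~~ b))%N.
Proof.
rewrite -big_split /= (eq_bigr (fun p => F (p.1, p.2))); last by case.
rewrite -(pair_bigA _ (fun w c => F (w, c)))/=.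
by apply: eq_bigr => w _; rewrite big_bool; case: b => //=; rewrite addnC.
Qed.

Lemma double_adj_same (v w : G) b : @adj double (v, b) (w, b) = adj v w.
Proof. by rewrite /= /double_adj /= eqxx. Qed.

Lemma double_adj_cross (v w : G) b : @adj double (v, b) (w, ~~ b) =
  (v == w) && (#|neighbors v| <= k)%N.
Proof. by rewrite /= /double_adj /=; case: b. Qed.

Lemma sum_eq1 (v : G) (F : G -> nat) : (\sum_w (v == w) * F w = F v)%N.
Proof.
rewrite (bigD1 v)//= eqxx mul1n big1 ?addn0// => w wv.
by rewrite eq_sym (negPf wv).
Qed.

Lemma double_deg (v : G) b :
  #|@neighbors double (v, b)| = (#|neighbors v| + (#|neighbors v| <= k))%N.
Proof.
rewrite degE (sum_double _ b); congr (_ + _)%N.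
  by rewrite degE; apply: eq_bigr => w _; rewrite double_adj_same.
rewrite -(sum_eq1 v (fun=> (#|neighbors v| <= k : nat)%N)).
apply: eq_bigr => w _.
by rewrite double_adj_cross; case: (v == w); rewrite ?mul1n.
Qed.

(** An edge between twins lies in no triangle, as a twin has no other neighbour in the opposite
    copy. *)
Lemma double_link (v : G) b : @link double (v, b) = link v.
Proof.
rewrite /link (sum_double _ b) [X in (_ + X)%N]big1; last first.
  move=> x _; rewrite (sum_double _ b) !big1// => y _.
    rewrite !double_adj_cross double_adj_same.
    by case: (v =P x) => //= <-; case: (v =P y) => [<-|_]; rewrite /= ?adj_irrefl ?andbF.
  rewrite double_adj_cross; case: (v =P x) => [<-|_]; last by [].
  rewrite double_adj_same.
  have := @double_adj_cross v y (~~ b); rewrite negbK => ->.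
  by case: (v =P y) => [<-|_]; rewrite /= ?adj_irrefl ?andbF.
rewrite addn0; apply: eq_bigr => x _; rewrite (sum_double _ b) [X in (_ + X)%N]big1 ?addn0.
  by apply: eq_bigr => y _; rewrite !double_adj_same.
move=> y _; rewrite !double_adj_cross double_adj_same.
by case: (v =P y) => [<-|_]; case: (x =P v) => [->|_]; rewrite /= ?adj_irrefl ?andbF.
Qed.

Lemma double_colorable C : colorable double C -> colorable G C.
Proof.
move=> /existsP[c /forallP cP]; apply/existsP; exists [ffun v => c (v, false)].
apply/forallP => x; apply/forallP => y; rewrite !ffunE.
by have /forallP/(_ (y, false)) := cP (x, false); rewrite double_adj_same.
Qed.
End Double.

Lemma regularize G r m C :
  (forall v : G, (#|neighbors v| <= r)%N) -> (forall v : G, (link v <= m)%N) ->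
  exists H : sgraph, [/\ forall v : H, #|neighbors v| = r,
    forall v : H, (link v <= m)%N & colorable H C -> colorable G C].
Proof.
move=> dG lG.
suff [H [dH lH cH]] : exists H : sgraph,
    [/\ forall v : H, (r <= #|neighbors v| <= r)%N,
        forall v : H, (link v <= m)%N & colorable H C -> colorable G C].
  by exists H; split=> // v; apply/eqP; rewrite eqn_leq andbC dH.
(* Only the lower degree bound is generalized: after [k] doublings, with thresholds 0, ..., k-1, all
   degrees lie between [k] and [r]. *)
have : (r <= r)%N by []; elim: {1 3}r => [|k IH] kr.
  by exists G; split.
have [H [dH lH cH]] := IH (ltnW kr).
exists (double H k); split=> [[v b]|[v b]|].
- rewrite double_deg; have := dH v; case: (leqP #|_| k); lia.
- by rewrite double_link.
- by move=> /double_colorable.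
Qed.

Section Greedy.
Variables (G : sgraph) (C : nat).
Implicit Type f : {ffun G -> option 'I_C}.

Definition partial_proper f :=
  forall (x y : G) a, adj x y -> f x = Some a -> f y <> Some a.

Definition seen f (v : G) : {set 'I_C} :=
  [set a | [exists w, adj v w && (f w == Some a)]].

Definition uncolored f (v : G) : {set G} := [set w | adj v w && (f w == None)].

(** Colouring [u] removes it from [uncolored] at each neighbour and adds at most one colour to
    [seen] there, so the sum never grows and a free colour always remains. *)
Lemma greedy f : partial_proper f ->
  (forall v, #|seen f v| + #|uncolored f v| < C)%N -> colorable G C.
Proof.
move: {2}_.+1 (ltnSn #|[set u | f u == None]|) => n.
elim: n f => // n IH f fn fP room.
have [u0|[u fu]] := set_0Vmem [set u | f u == None].
  have fS x : exists a, f x = Some a.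
    move/setP/(_ x): u0; rewrite !inE; case: (f x) => // a _; by exists a.
  have a0 (x : G) : 'I_C by have := fS x; case: (f x) => [a _|/cid[]//]; exact: a.
  apply/existsP; exists [ffun x => odflt (a0 x) (f x)].
  apply/forallP => x; apply/forallP => y; apply/implyP => xy; rewrite !ffunE.
  have [a fx] := fS x; have [b fy] := fS y; rewrite fx fy /=.
  by apply/eqP => ab; apply: (fP _ _ _ xy fx); rewrite ab.
rewrite inE in fu; move/eqP: fu => fu.
have [a au] : exists a, a \notin seen f u.
  apply/existsP; rewrite -negb_forall; apply/negP => /forallP all_seen.
  have := leq_ltn_trans (leq_addr _ _) (room u).
  suff -> : seen f u = [set: 'I_C] by rewrite cardsT card_ord ltnn.
  by apply/setP => a; rewrite all_seen inE.
pose g := [ffun x => if x == u then Some a else f x].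
have gE x : g x = if x == u then Some a else f x by rewrite ffunE.
have nu x : adj u x -> f x <> Some a.
  move=> ux fx; move/negP: au; apply; rewrite inE; apply/existsP.
  by exists x; rewrite ux fx eqxx.
apply: (IH g).
- rewrite -ltnS (leq_trans _ fn)// ltnS proper_card//.
  apply/fintype.properP; split; last by exists u; rewrite !inE ?fu// gE eqxx.
  by apply/fintype.subsetP => x; rewrite !inE gE; case: (x =P u).
- move=> x y b xy; rewrite !gE; case: eqP => [xu|_]; case: eqP => [yu|_].
  + by move: xy; rewrite xu yu adj_irrefl.
  + by move=> [<-]; apply: nu; rewrite -xu.
  + move=> fx [ab]; apply: (nu x); last by rewrite ab.
    by rewrite adj_sym -yu.
  + exact: fP.
- move=> v; have [vu|vu] := boolP (adj v u); last first.
    suff [-> ->] : seen g v = seen f v /\ uncolored g v = uncolored f v by [].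
    have gf w : adj v w -> g w = f w.
      by move=> vw; rewrite gE; case: eqP => // wu; rewrite -wu vw in vu.
    split; apply/setP => b; rewrite !inE.
      by apply: eq_existsb => w; have [/gf ->|] := boolP (adj v w).
    by have [/gf ->|] := boolP (adj v b).
  apply: leq_ltn_trans (room v).
  have uu : u \in uncolored f v by rewrite inE vu fu.
  rewrite (cardsD1 u (uncolored f v)) uu addnCA addnA leq_add//.
    rewrite (leq_trans (subset_leq_card (_ : seen g v \subset a |: seen f v)))//.
      apply/fintype.subsetP => b; rewrite !inE => /existsP[w /andP[vw]]; rewrite gE.
      case: (w =P u) => [_ /eqP[->]|_ fw]; first by rewrite eqxx.
      by apply/orP; right; apply/existsP; exists w; rewrite vw.
    by rewrite cardsU1 leq_add2r leq_b1.
  apply/subset_leq_card/fintype.subsetP => w; rewrite !inE gE.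
  by case: (w =P u) => //= _; rewrite andbF.
Qed.
End Greedy.

End Graphs.

(** Double counting of incidences between vertices and edges, the edges being transported to
    two-element sets of vertices of [G]. *)
Lemma link_le_edges (G : sgraph) (v : G) :
  (link v <= 2 * #|edges (induced_subgraph (neighbors v))|)%N.
Proof.
pose H := induced_subgraph (neighbors v).
pose F : {set {set G}} := [set val @: E | E : {set H} in edges H].
have F2 E : E \in F -> (#|E| <= 2)%N.
  move=> /imsetP[E' ]; rewrite inE => /existsP[x /existsP[y /andP[_ /eqP ->]]] ->.
  by rewrite (leq_trans (leq_imset_card _ _))// cards2; case: eqP.
have FE x y : adj v x -> adj v y -> adj x y -> [set x; y] \in F.
  move=> vx vy xy.
  have xN : x \in neighbors v by rewrite inE.
  have yN : y \in neighbors v by rewrite inE.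
  apply/imsetP; exists [set (exist _ x xN : H); (exist _ y yN : H)].
    by rewrite inE; apply/existsP; exists (exist _ x xN : H); apply/existsP;
      exists (exist _ y yN : H); rewrite eqxx andbT.
  by rewrite imsetU1 imset_set1.
apply: (@leq_trans (2 * #|F|)); last by rewrite leq_mul2l leq_imset_card.
apply: (@leq_trans (\sum_(E in F) #|E|)); last first.
  by rewrite mulnC -sum_nat_const leq_sum.
have -> : (\sum_(E in F) #|E| = \sum_x #|[set E in F | x \in E]|)%N.
  rewrite (eq_bigr (fun E : {set G} => \sum_x (x \in E : nat)))%N; last first.
    by move=> E _; rewrite -sum1_card big_mkcond; apply: eq_bigr => x _; case: (x \in E).
  rewrite exchange_big; apply: eq_bigr => x _ /=.
  rewrite -sum1_card [RHS](eq_bigl (fun E => (E \in F) && (x \in E)));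
    last by move=> E; rewrite inE.
  by rewrite [RHS]big_mkcondr; apply: eq_bigr => E _; case: (x \in E).
apply: leq_sum => x _.
have [vx|vx] := boolP (adj v x); last first.
  by rewrite big1// => y _.
apply: (@leq_trans #|[set [set x; y] | y in [set y | adj v y && adj x y]]|).
  rewrite card_in_imset.
    rewrite -sum1_card [leqRHS]big_mkcond; apply: leq_sum => y _.
    by rewrite inE /=; case: (_ && _).
  move=> y z; rewrite !inE => /andP[_ xy] _ /setP/(_ y); rewrite !inE eqxx orbT.
  by case: (y =P x) => [yx|_ /esym/eqP//]; rewrite yx adj_irrefl in xy.
apply/subset_leq_card/fintype.subsetP => E /imsetP[y]; rewrite inE => /andP[vy xy] ->.
by rewrite !inE eqxx FE.
Qed.

(** * The random partial colouring *)

Section Model.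
Variables (R : realType) (G : sgraph) (C : nat).

Definition label := ('I_C * {ffun G -> bool})%type.
Local Notation Omega := {ffun G -> label}.
Implicit Types (w : Omega) (x y v : G) (a : 'I_C).

(* In a conflict between equally coloured neighbours [x] and [y], the sum of *)
(* one random bit at either end decides who loses its colour, so that given  *)
(* the label of [x], this is a fair coin read from the label of [y] alone.   *)
Definition beats w y x :=
  [&& adj x y, (w x).1 == (w y).1 &
      (w x).2 y (+) (w y).2 x (+) (enum_rank x < enum_rank y)%N].

Definition kept w x := [forall y, ~~ beats w y x].

(** Exchanging the two ends keeps both bits but reverses the rank comparison, so in a monochromatic
    edge exactly one end beats the other. *)
Lemma kept_adj w x y :
  adj x y -> kept w x -> kept w y -> (w x).1 != (w y).1.
Proof.
move=> xy /forallP/(_ y) + /forallP/(_ x); rewrite /beats [adj y x]adj_sym xy /=.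
rewrite [(w x).1 == _]eq_sym; case: eqP => //= _.
case: ltngtP => [_|_|/val_inj/enum_rank_inj xE]; last by rewrite xE adj_irrefl in xy.
all: by case: ((w x).2 y); case: ((w y).2 x).
Qed.

Definition kept_class w v a : {set G} :=
  [set x in neighbors v | kept w x && ((w x).1 == a)].

(* The truncation at 2 bounds the influence of a single label, and is        *)
(* harmless: C(k,2) - C(k,3) <= min(k-1,2).                                  *)
Definition saved w v : nat := \sum_a minn #|kept_class w v a|.-1 2.

Lemma sum_eq_ord (c : 'I_C) : (\sum_a (c == a) = 1)%N.
Proof.
rewrite (bigD1 c)//= eqxx big1// => a ac; by rewrite eq_sym (negPf ac).
Qed.

Lemma card_set_sum (T : finType) (P : pred T) : #|[set x | P x]| = (\sum_x P x)%N.
Proof.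
by rewrite -sum1_card big_mkcond; apply: eq_bigr => x _; rewrite inE; case: (P x).
Qed.

(** A nonempty class of k surviving vertices shows one colour, and its contribution to [saved] is at
    most k - 1. Summing over colours bounds [seen] plus [saved] by the number of coloured
    neighbours. *)
Lemma colorable_of_saved w :
  (forall v, #|neighbors v| < C + saved w v)%N -> colorable G C.
Proof.
move=> room.
pose f : {ffun G -> option 'I_C} := [ffun x => if kept w x then Some (w x).1 else None].
have fE x : f x = if kept w x then Some (w x).1 else None by rewrite ffunE.
apply: (@greedy G C f) => [x y a xy|v].
  rewrite !fE; case: ifP => // kx [<-]; case: ifP => // ky [yx].
  by have := kept_adj xy kx ky; rewrite yx eqxx.
have seenE : #|seen f v| = (\sum_a (0 < #|kept_class w v a|))%N.
  rewrite card_set_sum; apply: eq_bigr => a _; congr nat_of_bool.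
  rewrite card_gt0; apply/existsP/set0Pn => [[x /andP[vx]]|[x]].
    rewrite fE; case: ifP => // kx /eqP[cx]; exists x.
    by rewrite !inE vx kx cx eqxx.
  by rewrite !inE => /and3P[vx kx /eqP cx]; exists x; rewrite vx fE kx cx /=.
have uncE : (#|neighbors v| = #|uncolored f v| + \sum_a #|kept_class w v a|)%N.
  rewrite (eq_bigr (fun a => \sum_x
       ([&& adj v x, kept w x & (w x).1 == a] : nat)))%N; last first.
    by move=> a _; rewrite card_set_sum; apply: eq_bigr => x _; rewrite inE.
  rewrite exchange_big degE card_set_sum -big_split; apply: eq_bigr => x _ /=.
  rewrite fE; case: (adj v x) => /=; last by rewrite big1.
  by case: (kept w x); rewrite /= ?sum_eq_ord// big1.
have := room v; rewrite uncE.
suff : (#|seen f v| + saved w v <= \sum_a #|kept_class w v a|)%N by lia.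
by rewrite seenE -big_split leq_sum// => a _; case: #|_| => // k; rewrite /= add1n ltnS geq_minl.
Qed.

Section Probability.
Hypothesis C0 : (0 < C)%N.
Variables (U : {set G}) (a : 'I_C).
Hypothesis Uind : {in U &, forall x y, ~~ adj x y}.

Definition all_kept w := [forall x in U, kept w x && ((w x).1 == a)].

(** With all of [U] coloured [a] and its labels frozen in [w], label [t] at [y] uncolours no member
    of [U]. As only [t] varies, these events are independent over [y]. *)
Definition spares w y (t : label) := ~~ ((t.1 == a) && [exists x in U,
  adj x y && ((w x).2 y (+) t.2 x (+) (enum_rank x < enum_rank y)%N)]).

Lemma all_kept_mix w1 w : all_kept (mix (~: U) w1 w) =
  [forall x in U, (w x).1 == a] && [forall y, spares w y (w1 y)].
Proof.
apply/forall_inP/andP => [kU|[/forall_inP cU /forallP sU] x xU].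
  have cU x : x \in U -> (w x).1 == a.
    by move=> xU; have /andP[_] := kU x xU; rewrite ffunE inE xU.
  split; [exact/forall_inP | apply/forallP => y; apply/negP].
  move=> /andP[ya /exists_inP[x xU /andP[xy bit]]].
  have /andP[/forallP/(_ y)/negP[]] := kU x xU.
  have yU : y \notin U by apply: contraTN xy; exact: Uind.
  by rewrite /beats !ffunE !inE xU yU /= xy (eqP (cU x xU)) eq_sym ya.
rewrite ffunE inE xU cU// andbT; apply/forallP => y; apply/negP => /and3P[xy].
have yU : y \notin U by apply: contraTN xy; exact: Uind.
rewrite !ffunE !inE xU yU /= => cxy bit; have /negP[] := sU y.
by rewrite -(eqP cxy) cU//; apply/exists_inP; exists x; rewrite ?xy.
Qed.

Definition nbr_count y := #|[set x in U | adj x y]|.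

Lemma card_ffun_bool : (0 < #|{ffun G -> bool}|)%N.
Proof. by rewrite card_ffun expn_gt0 card_bool. Qed.

Lemma card_label : (0 < #|{: label}|)%N.
Proof. by rewrite card_prod card_ord muln_gt0 C0 card_ffun_bool. Qed.

Lemma mean_color : mean (fun c : 'I_C => (c == a)%:R) = C%:R^-1 :> R.
Proof.
rewrite /mean card_ord (bigD1 a)//= eqxx big1 ?addr0 ?mul1r//.
by move=> c /negPf ->.
Qed.

Lemma mean_spares w y : mean (fun t : label => (spares w y t)%:R) =
  1 - C%:R^-1 * (1 - 2^-1 ^+ nbr_count y) :> R.
Proof.
pose bit x (b : bool) := (w x).2 y (+) b (+) (enum_rank x < enum_rank y)%N.
pose g x (b : bool) : R := (~~ [&& x \in U, adj x y & bit x b])%:R.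
have gP : mean (fun b : {ffun G -> bool} => \prod_x g x (b x)) = 2^-1 ^+ nbr_count y.
  rewrite mean_ffun_prod (bigID (fun x => (x \in U) && adj x y)) /=.
  rewrite [X in _ * X]big1 ?mulr1; last first.
    move=> x xP; apply: mean_const => [|b]; first by rewrite card_bool.
    by rewrite /g andbA (negPf xP).
  rewrite (eq_bigr (fun=> 2^-1)); last first.
    move=> x /andP[xU xy]; rewrite /mean card_bool big_bool /g xU xy /bit /=.
    by case: ((w x).2 y); case: (enum_rank x < _)%N; rewrite /= ?add0r ?addr0 mul1r.
  by rewrite prodr_const; congr (_ ^+ _); apply: eq_card => x; rewrite inE.
rewrite mean_pair.
rewrite (@eq_mean _ _ _ (fun c => 1 - (1 - 2^-1 ^+ nbr_count y) * (c == a)%:R)).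
  by rewrite meanB meanZ mean_color mean_cst ?card_ord// mulrC.
move=> c; rewrite -gP.
rewrite (@eq_mean _ _ _ (fun b : {ffun G -> bool} =>
    1 - (c == a)%:R * (1 - \prod_x g x (b x)))).
  by rewrite meanB meanZ meanB !mean_cst ?card_ffun_bool// mulrC.
move=> b; rewrite /spares /=; case: (c == a) => /=; last by rewrite mul0r subr0.
rewrite mul1r subKr; case: exists_inP => [[x xU /andP[xy bx]]|nex].
  by rewrite (bigD1 x)//= {1}/g /bit xU xy bx mul0r.
rewrite big1// => x _; rewrite /g; case: and3P => // -[xU xy bx].
by case: nex; exists x; rewrite ?xy.
Qed.

Lemma pr_all_kept : pr R all_kept =
  C%:R^-1 ^+ #|U| * \prod_y (1 - C%:R^-1 * (1 - 2^-1 ^+ nbr_count y)).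
Proof.
rewrite /pr -(mean_mean_on card_label (~: U)) /mean_on.
set P := \prod_y _.
rewrite (@eq_mean _ _ _ (fun w => P * \prod_x (~~ ((x \in U) && ((w x).1 != a)))%:R)).
  rewrite meanZ mulrC; congr (_ * _).
  rewrite (@mean_ffun_prod R G label (fun x t => (~~ ((x \in U) && (t.1 != a)))%:R)).
  rewrite (bigID (mem U)) /= [X in _ * X]big1 ?mulr1; last first.
    move=> x /negPf xU; apply: mean_const => [|t]; first exact: card_label.
    by rewrite xU.
  rewrite (eq_bigr (fun=> C%:R^-1)) ?prodr_const// => x xU.
  rewrite mean_pair -mean_color; apply: eq_mean => c.
  by rewrite xU /= negbK mean_cst// card_ffun_bool.
move=> w; have [cU|cU] := boolP [forall x in U, (w x).1 == a].
  rewrite [X in _ = _ * X]big1; last first.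
    by move=> x _; case: (boolP (x \in U)) => //= xU; rewrite negbK (forall_inP cU).
  rewrite mulr1 /P; under [RHS]eq_bigr do rewrite -(mean_spares w).
  rewrite -mean_ffun_prod; apply: eq_mean => w1; rewrite all_kept_mix cU /=.
  case: forallP => [sp|/forallP]; first by rewrite big1// => y _; rewrite sp.
  by rewrite negb_forall => /existsP[y /negPf sp]; rewrite (bigD1 y)//= sp mul0r.
rewrite [LHS](@mean_const _ _ _ 0); first last.
- by move=> w1; rewrite all_kept_mix (negPf cU).
- by rewrite card_Omega ?card_label.
move: cU; rewrite negb_forall_in => /exists_inP[x xU /negPf cx].
by rewrite (bigD1 x)//= xU cx mul0r mulr0.
Qed.

End Probability.
End Model.

(** * Expected saving at a vertex of a regular graph *)

Section Expectation.
Variables (R : realType) (G : sgraph) (C r : nat).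
Hypothesis C0 : (0 < C)%N.
Hypothesis reg : forall v : G, #|neighbors v| = r.
Local Notation Omega := {ffun G -> label G C}.
Implicit Types (w : Omega) (x y z v : G) (a : 'I_C).

Lemma sum_nbr_count (U : {set G}) : (\sum_y nbr_count U y = #|U| * r)%N.
Proof.
rewrite (eq_bigr (fun y => \sum_(x in U) (adj x y : nat)))%N; last first.
  move=> y _; rewrite /nbr_count card_set_sum [RHS]big_mkcond; apply: eq_bigr => x _.
  by case: (x \in U).
rewrite exchange_big -sum_nat_const; apply: eq_bigr => x _ /=.
by rewrite -degE reg.
Qed.

Lemma nbr_count_le (U : {set G}) y : (nbr_count U y <= #|U|)%N.
Proof.
by apply/subset_leq_card/fintype.subsetP => x; rewrite inE => /andP[].
Qed.

Let c : R := C%:R^-1.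

Let c01 : 0 <= c <= 1.
Proof. by rewrite /c invr_ge0 ler0n invf_le1 ?ltr0n// ler1n C0. Qed.

(** A vertex with j <= 2 neighbours in [U] contributes 1 - c(1 - 2^-j) >= (1 - c/2)^j, and by
    regularity the j sum to 2r. *)
Lemma pr_all_kept_ge (U : {set G}) a : {in U &, forall x y, ~~ adj x y} ->
  #|U| = 2%N -> c ^+ 2 * (1 - c / 2) ^+ (2 * r) <= pr R (all_kept U a).
Proof.
move=> Uind U2; rewrite pr_all_kept// U2 -/c ler_wpM2l ?sqr_ge0//.
have -> : (2 * r = \sum_y nbr_count U y)%N by rewrite sum_nbr_count U2.
rewrite -prodrXr; apply: ler_prod => y _.
have /andP[c0 c1] := c01.
rewrite exprn_ge0 /=; last by lra.
have := nbr_count_le U y; rewrite U2; case: (nbr_count U y) => [|[|[|//]]] _.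
all: rewrite ?expr0 ?expr1 ?expr2; nra.
Qed.

(** For j <= 3, 1 - 2^-j >= 7j/24, with equality at j = 3; the j sum to 3r, whence the exponent
    7/8. *)
Lemma pr_all_kept_le (U : {set G}) a : {in U &, forall x y, ~~ adj x y} ->
  #|U| = 3%N -> pr R (all_kept U a) <= c ^+ 3 * expR (- (7 / 8 * r%:R * c)).
Proof.
move=> Uind U3; rewrite pr_all_kept// U3 -/c.
have /andP[c0 c1] := c01.
rewrite ler_wpM2l ?exprn_ge0//.
have -> : expR (- (7 / 8 * r%:R * c)) = \prod_y expR (- (7 / 24 * c)) ^+ nbr_count U y.
  by rewrite prodrXr sum_nbr_count U3 -expRM_natr natrM; congr expR; field.
apply: ler_prod => y _.
have j3 : (nbr_count U y <= 3)%N by rewrite -U3 nbr_count_le.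
apply/andP; split.
  rewrite subr_ge0 mulr_ile1// ?subr_ge0 ?gerBl ?exprn_ge0// ?exprn_ile1//; lra.
rewrite -expRM_natr; apply: (le_trans (expR_ge1Dx _)); rewrite ler_expR mulNr lerN2.
move: j3; case: (nbr_count U y) => [|[|[|[|//]]]] _.
all: rewrite ?expr0 ?expr1 ?exprS ?expr0; nra.
Qed.

(** Six times the inequality C(k,2) - C(k,3) <= min(k-1, 2); from k = 5 on the triples alone
    outnumber the pairs. *)
Lemma min2_ge_pairs_triples k :
  (3 * (k * k.-1) <= 6 * minn k.-1 2 + k * k.-1 * k.-2)%N.
Proof. case: k => [|[|[|[|[|k]]]]] //=; rewrite (minn_idPr _)//; nia. Qed.

Lemma card_pairs (K : {set G}) :
  (#|K| * #|K|.-1 = \sum_x \sum_y [&& x \in K, y \in K & x != y])%N.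
Proof.
rewrite -sum_nat_const big_mkcond; apply: eq_bigr => x _.
have [xK|_] := boolP (x \in K); last by rewrite big1.
rewrite (cardsD1 x K) xK /= -card_set_sum; apply: eq_card => y.
by rewrite !inE eq_sym andbC.
Qed.

Lemma card_triples (K : {set G}) : (#|K| * #|K|.-1 * #|K|.-2 =
  \sum_x \sum_y \sum_z
    [&& x \in K, y \in K, z \in K, x != y, y != z & z != x])%N.
Proof.
rewrite card_pairs big_distrl; apply: eq_bigr => x _ /=.
rewrite big_distrl; apply: eq_bigr => y _ /=.
have [/and3P[xK yK xy]|nxy] := boolP [&& x \in K, y \in K & x != y]; last first.
  rewrite mul0n big1// => z _; apply/eqP; rewrite eqb0; apply: contra nxy.
  by move=> /and5P[-> -> _ ->].
have -> : #|K| = #|K :\ x :\ y|.+2.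
  by rewrite (cardsD1 x K) xK (cardsD1 y (K :\ x)) !inE yK eq_sym xy.
rewrite mul1n -card_set_sum /=; apply: eq_card => z.
rewrite !inE xK yK xy /= [y == z]eq_sym.
by case: (z \in K); rewrite /= ?andbT ?andbF.
Qed.

Variable v : G.

Definition nonadj x y := [&& adj v x, adj v y, x != y & ~~ adj x y].

(** Ordered counts: twice the number of nonadjacent pairs in the neighbourhood, and below, six times
    the number of independent triples. *)
Definition npairs : nat := \sum_x \sum_y nonadj x y.
Definition ntriples : nat := \sum_x \sum_y \sum_z [&& nonadj x y, nonadj y z & nonadj z x].

Lemma npairs_link : (npairs + link v = r * r.-1)%N.
Proof.
rewrite -(reg v) card_pairs -big_split; apply: eq_bigr => x _ /=.
rewrite -big_split; apply: eq_bigr => y _ /=; rewrite !inE /nonadj.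
case: (adj v x) => //; case: (adj v y) => //=; case: eqP => [->|_] /=.
  by rewrite adj_irrefl.
by case: (adj x y).
Qed.

Lemma ntriples_npairs : (ntriples ^ 2 <= npairs ^ 3)%N.
Proof.
rewrite -(ler_nat R) !natrX.
have -> : ntriples%:R = \sum_x \sum_y
    (nonadj x y)%:R * (\sum_z (nonadj y z)%:R * (nonadj z x)%:R) :> R.
  rewrite natr_sum; apply: eq_bigr => x _; rewrite natr_sum; apply: eq_bigr => y _.
  rewrite natr_sum mulr_sumr; apply: eq_bigr => z _; rewrite -!natrM.
  by rewrite !mulnb.
apply: (le_trans (triangle_count_le _)); rewrite le_eqVlt; apply/orP; left; apply/eqP.
congr (_ ^+ 3); rewrite natr_sum; apply: eq_bigr => x _.
rewrite natr_sum; apply: eq_bigr => y _; rewrite -natrX.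
by case: (nonadj x y).
Qed.

(** [min2_ge_pairs_triples] in each colour class; by [kept_adj] a class is an independent set, so
    its triples are among those counted by [ntriples]. *)
Lemma saved_ge w : (3 * \sum_a \sum_x \sum_y (nonadj x y && all_kept [set x; y] a w) <=
  6 * saved w v + \sum_a \sum_x \sum_y \sum_z
   ([&& nonadj x y, nonadj y z & nonadj z x] && all_kept [set x; y; z] a w))%N.
Proof.
rewrite /saved !big_distrr -big_split leq_sum// => a _ /=.
apply: leq_trans (leq_trans (min2_ge_pairs_triples #|kept_class w v a|) _).
  rewrite leq_mul2l /= card_pairs leq_sum// => x _; rewrite leq_sum// => y _.
  rewrite !inE; case: andP => // -[/and4P[-> -> -> _] /forall_inP kU].
  by rewrite !kU ?inE ?eqxx ?orbT.
rewrite leq_add2l card_triples leq_sum// => x _; rewrite leq_sum// => y _.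
rewrite leq_sum// => z _; rewrite !inE.
have [|//] := boolP [&& _ , _ , _ , _ , _ & _].
move=> /and5P[/and3P[vx kx cx] /and3P[vy ky cy] /and3P[vz kz cz] xy /andP[yz zx]].
have na p q : kept w p -> kept w q -> (w p).1 == a -> (w q).1 == a -> ~~ adj p q.
  move=> kp kq /eqP cp /eqP cq; apply/negP => pq.
  by have := kept_adj pq kp kq; rewrite cp cq eqxx.
rewrite /nonadj vx vy vz xy yz zx !na//= lt0b.
by apply/forall_inP => u; rewrite !inE => /orP[/orP[]|] /eqP ->; apply/andP.
Qed.

(** Linearity of expectation in [saved_ge]; summing over the C colours cancels one factor [c] in
    each probability. *)
Lemma mean_saved_ge :
  3 * npairs%:R * c * (1 - c / 2) ^+ (2 * r)
    - ntriples%:R * c ^+ 2 * expR (- (7 / 8 * r%:R * c)) <=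
  6 * mean (fun w => (saved w v)%:R : R).
Proof.
have Cc : C%:R * c = 1 by rewrite /c mulfV// pnatr_eq0 -lt0n.
have adj2 x y : nonadj x y -> {in [set x; y] &, forall p q, ~~ adj p q}.
  move=> /and4P[_ _ _ xy] p q; rewrite !inE => /orP[] /eqP -> /orP[] /eqP ->;
  by rewrite ?adj_irrefl// adj_sym.
have adj3 x y z : [&& nonadj x y, nonadj y z & nonadj z x] ->
    {in [set x; y; z] &, forall p q, ~~ adj p q}.
  move=> /and3P[/and4P[_ _ _ xy] /and4P[_ _ _ yz] /and4P[_ _ _ zx]] p q.
  by rewrite !inE => /orP[/orP[]|] /eqP -> /orP[/orP[]|] /eqP ->;
    rewrite ?adj_irrefl// adj_sym.
pose P2 w := (\sum_a \sum_x \sum_y (nonadj x y && all_kept [set x; y] a w))%N.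
pose P3 w := (\sum_a \sum_x \sum_y \sum_z
   ([&& nonadj x y, nonadj y z & nonadj z x] && all_kept [set x; y; z] a w))%N.
have : 3 * mean (fun w => (P2 w)%:R : R) <=
    6 * mean (fun w => (saved w v)%:R : R) + mean (fun w => (P3 w)%:R).
  rewrite -!meanZ -meanD; apply: le_mean => w; rewrite -!natrM -natrD ler_nat.
  exact: saved_ge.
have mP2 : npairs%:R * c * (1 - c / 2) ^+ (2 * r) <= mean (fun w => (P2 w)%:R : R).
  rewrite (eq_mean (g := fun w => \sum_a \sum_x \sum_y
      (nonadj x y)%:R * (all_kept [set x; y] a w)%:R)); last first.
    move=> w; rewrite natr_sum; apply: eq_bigr => a _; rewrite natr_sum.
    apply: eq_bigr => x _; rewrite natr_sum; apply: eq_bigr => y _.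
    by rewrite -natrM mulnb.
  rewrite mean_sum; apply: (@le_trans _ _ (\sum_(a < C)
      npairs%:R * (c ^+ 2 * (1 - c / 2) ^+ (2 * r)))).
    rewrite sumr_const card_ord -[_ *+ C]mulr_natr.
    set q := _ ^+ (2 * r). set n := npairs%:R.
    rewrite (_ : n * (c ^+ 2 * q) * _ = n * c * q * (C%:R * c)); last by ring.
    by rewrite Cc mulr1.
  apply: ler_sum => a _; rewrite mean_sum natr_sum mulr_suml.
  apply: ler_sum => x _; rewrite mean_sum natr_sum mulr_suml.
  apply: ler_sum => y _; rewrite meanZ.
  have [xy|_] := boolP (nonadj x y); last by rewrite !mul0r.
  rewrite !mul1r pr_all_kept_ge//; first exact: adj2.
  by have /and4P[_ _ ne _] := xy; rewrite cards2 ne.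
have mP3 : mean (fun w => (P3 w)%:R : R) <=
    ntriples%:R * c ^+ 2 * expR (- (7 / 8 * r%:R * c)).
  rewrite (eq_mean (g := fun w => \sum_a \sum_x \sum_y \sum_z
      ([&& nonadj x y, nonadj y z & nonadj z x])%:R * (all_kept [set x; y; z] a w)%:R)); last first.
    move=> w; rewrite natr_sum; apply: eq_bigr => a _; rewrite natr_sum.
    apply: eq_bigr => x _; rewrite natr_sum; apply: eq_bigr => y _.
    by rewrite natr_sum; apply: eq_bigr => z _; rewrite -natrM mulnb.
  rewrite mean_sum; apply: (@le_trans _ _ (\sum_(a < C)
      ntriples%:R * (c ^+ 3 * expR (- (7 / 8 * r%:R * c))))); last first.
    rewrite sumr_const card_ord -[_ *+ C]mulr_natr.
    set q := expR _. set n := ntriples%:R.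
    rewrite (_ : n * (c ^+ 3 * q) * _ = n * c ^+ 2 * q * (C%:R * c)); last by ring.
    by rewrite Cc mulr1.
  apply: ler_sum => a _; rewrite mean_sum natr_sum mulr_suml.
  apply: ler_sum => x _; rewrite mean_sum natr_sum mulr_suml.
  apply: ler_sum => y _; rewrite mean_sum natr_sum mulr_suml.
  apply: ler_sum => z _; rewrite meanZ.
  have [xyz|_] := boolP [&& nonadj x y, nonadj y z & nonadj z x]; last by rewrite !mul0r.
  rewrite !mul1r pr_all_kept_le//; first exact: adj3.
  have /and3P[/and4P[_ _ xy _] /and4P[_ _ yz _] /and4P[_ _ zx _]] := xyz.
  by rewrite [[set x; y; z]]finset.setUC cardsU1 cards2 !inE negb_or zx eq_sym yz xy.
move: mP2 mP3.
move: (_ ^+ (2 * r)) (expR _) (npairs%:R) (ntriples%:R) (mean _) (mean _) (mean _).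
by move=> q e n t X Y Z; lra.
Qed.

End Expectation.

(** * Concentration *)

Section Concentration.
Variables (R : realType) (G : sgraph) (C r : nat).
Hypothesis C0 : (0 < C)%N.
Hypothesis reg : forall v : G, #|neighbors v| = r.
Local Notation Omega := {ffun G -> label G C}.
Implicit Types (w : Omega) (x y z v : G) (a : 'I_C).

Lemma kept_class_off x v a z w w' : (forall y, y != x -> w y = w' y) ->
  z != x -> (adj z x -> (w' x).1 != a) ->
  z \in kept_class w v a -> z \in kept_class w' v a.
Proof.
move=> ww zx xa; rewrite !inE => /and3P[-> /forallP kz /eqP cz].
rewrite -ww// cz eqxx /= andbT; apply/forallP => y.
have [->|yx] := eqVneq y x; last by rewrite /beats -!ww//; exact: kz.
apply/negP => /and3P[/xa/negP na]; rewrite -(ww z)// cz => /eqP ac _.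
by apply: na; rewrite ac.
Qed.

(** Only the classes of the old and the new colour of [x] can change, and each term is truncated at
    2. *)
Lemma saved_lipschitz x v w w' : (forall y, y != x -> w y = w' y) ->
  (saved w v <= saved w' v + 4)%N.
Proof.
move=> ww.
have -> : 4%N = (\sum_a (2 * ((w x).1 == a) + 2 * ((w' x).1 == a)))%N.
  by rewrite big_split -!big_distrr /= !sum_eq_ord.
rewrite /saved -big_split leq_sum// => a _ /=.
have [_|na] := eqVneq (w x).1 a; first by rewrite muln1; lia.
have [_|na'] := eqVneq (w' x).1 a; first by rewrite muln1; lia.
rewrite !muln0 !addn0.
suff /subset_leq_card : kept_class w v a \subset kept_class w' v a by lia.
apply/fintype.subsetP => z zw; apply: (kept_class_off ww) (zw) => //.
by apply: contraNneq na => <-; move: zw; rewrite inE => /and3P[].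
Qed.

Definition nbr_colors w x v : {set 'I_C} :=
  [set (w z).1 | z in neighbors x :&: neighbors v].

(** A vertex outside the neighbourhood of [v] acts only by conflicting with a common neighbour,
    which requires sharing its colour. *)
Lemma saved_off x v w w' : (forall y, y != x -> w y = w' y) ->
  ~~ adj v x -> (w x).1 \notin nbr_colors w x v ->
  (w' x).1 \notin nbr_colors w x v -> saved w v = saved w' v.
Proof.
move=> ww vx cx cx'; apply: eq_bigr => a _; congr (minn (_.-1) _).
have ww' y : y != x -> w' y = w y by move=> yx; rewrite ww.
have zx b z w1 : z \in kept_class w1 v b -> z != x.
  by rewrite inE => /andP[zv _]; apply: contraNneq vx => <-; rewrite inE in zv.
have cz w1 z : (forall y, y != x -> w y = w1 y) -> z \in kept_class w1 v a ->
    adj z x -> a \in nbr_colors w x v.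
  move=> ww1 zw xz; apply/imsetP; exists z.
    by move: zw; rewrite !inE [adj x z]adj_sym xz => /andP[].
  rewrite (ww1 z (zx _ _ _ zw)); move: zw; rewrite inE => /and3P[_ _ /eqP//].
apply: eq_card => z; apply/idP/idP => zw.
  apply: (kept_class_off ww _ _ zw); first exact: zx zw.
  by move=> /(cz w z (fun _ _ => erefl) zw) aS; apply: contraNneq cx' => ->.
apply: (kept_class_off ww' _ _ zw); first exact: zx zw.
by move=> /(cz w' z ww zw) aS; apply: contraNneq cx => ->.
Qed.

(** The squared change 4^2 times a bound on the probability that the label of [x] matters to [v]. *)
Definition influence v x : R :=
  16 * ((adj v x)%:R + C%:R^-1 * #|neighbors x :&: neighbors v|%:R).

Lemma mix_off x w1 w y : y != x -> w y = mix [set x] w1 w y.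
Proof. by move=> /negPf yx; rewrite ffunE inE yx. Qed.

Lemma small_var_saved v x :
  small_var 4 (influence v) x (fun w => (saved w v)%:R : R).
Proof.
move=> w; set f := fun w : Omega => _ : R.
have cO : (0 < #|Omega|)%N := card_Omega G (card_label G C0).
have f4 w1 w2 : (forall y, y != x -> w1 y = w2 y) -> `|f w1 - f w2| <= 4.
  move=> ww; have := saved_lipschitz v ww.
  have := @saved_lipschitz x v w2 w1 (fun y yx => esym (ww y yx)).
  rewrite -!(ler_nat R) !natrD ler_norml /f; lra.
have f16 w1 w2 : (forall y, y != x -> w1 y = w2 y) -> (f w1 - f w2) ^+ 2 <= 16.
  by move=> /f4; rewrite -real_normK ?num_real// => ?; have := normr_ge0 (f w1 - f w2); nra.
have dE w1 : dev x f w1 = mean (fun w2 => f w1 - f (mix [set x] w2 w1)).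
  by rewrite meanB mean_cst.
split.
  by rewrite dE mean_norm_le// => w1; apply: f4 => y yx; exact: mix_off.
pose g w1 := f (mix [set x] w1 w).
have -> : mean_on [set x] (fun w1 => dev x f w1 ^+ 2) w =
    mean (fun w1 => (g w1 - mean g) ^+ 2).
  apply: eq_mean => w1; congr (_ ^+ 2); rewrite /dev; congr (_ - _).
  apply: eq_mean => w2; congr f; apply/ffunP => y; rewrite !ffunE.
  by case: (y \in _).
have gg w1 w2 y : y != x -> mix [set x] w1 w y = mix [set x] w2 w y.
  by move=> /negPf yx; rewrite !ffunE inE yx.
pose D w1 := adj v x || ((w1 x).1 \in nbr_colors w x v).
apply: (@le_trans _ _ (16 * mean (fun w1 => (D w1)%:R))).
  (* All labels of [x] outside [D] yield the same saving. That value serves as [k]; the variance is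
     at most the mean square deviation from any constant. *)
  have [k kP] : exists k, forall w1, (g w1 - k) ^+ 2 <= 16 * (D w1)%:R.
    have [/existsP[w0 D0]|/existsPn all_D] := boolP [exists w1, ~~ D w1].
      exists (g w0) => w1; case D1 : (D w1); first by rewrite mulr1 f16// => y; exact: gg.
      move/negbT: D1; move: D0; rewrite /D !negb_or => /andP[vx c0] /andP[_ c1].
      have E w2 : (w2 x).1 \notin nbr_colors w x v -> g w2 = g w0.
        move=> c2; rewrite /g /f; congr (_%:R).
        have nE : nbr_colors (mix [set x] w2 w) x v = nbr_colors w x v.
          apply: eq_in_imset => z; rewrite !inE => /andP[xz _].
          by rewrite -mix_off//; apply: contraTneq xz => ->; rewrite adj_irrefl.
        apply: (@saved_off x) => //; first exact: gg.
          by rewrite nE ffunE inE eqxx.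
        by rewrite nE ffunE inE eqxx.
      by rewrite E// subrr expr0n mulr_ge0.
    exists (g w) => w1; move: (all_D w1); rewrite negbK => ->.
    by rewrite mulr1 f16// => y; exact: gg.
  by rewrite (le_trans (mean_var_le g k cO))// -meanZ le_mean.
rewrite /influence ler_wpM2l//.
apply: (@le_trans _ _ (mean (fun w1 => (adj v x)%:R +
     ((w1 x).1 \in nbr_colors w x v)%:R))).
  by apply: le_mean => w1; rewrite -natrD ler_nat /D; case: adj; case: (_ \in _).
rewrite meanD mean_cst// lerD2l.
rewrite (mean_coord (card_label G C0) x (fun t : label G C => (t.1 \in nbr_colors w x v)%:R)).
rewrite mean_pair (eq_mean (g := fun c => (c \in nbr_colors w x v)%:R)); last first.
  by move=> c; rewrite /= mean_cst ?card_ffun_bool.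
rewrite /mean card_ord mulrC ler_wpM2l ?invr_ge0// -natr_sum ler_nat.
apply: leq_trans (leq_imset_card (fun z => (w z).1) _).
by rewrite -sum1_card [leqRHS]big_mkcond leq_sum// => c _; case: (_ \in _).
Qed.

(** The common-neighbour counts add up to the r^2 walks of length two from [v]. With C of order r
    the total is O(r). *)
Lemma sum_influence v : \sum_x influence v x = 16 * (r%:R + C%:R^-1 * r%:R ^+ 2).
Proof.
rewrite -mulr_sumr big_split /= -natr_sum -degE reg -mulr_sumr -natr_sum -natrX.
congr (_ * (_ + _ * _%:R)).
have := sum_nbr_count reg (neighbors v); rewrite reg mulnn => <-; apply: eq_bigr => x _.
by apply: eq_card => z; rewrite !inE andbC [adj x z]adj_sym.
Qed.

Definition ball v : {set G} := [set y | adj v y || [exists u, adj v u && adj u y]].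

Lemma ball_sym v y : (y \in ball v) = (v \in ball y).
Proof.
rewrite !inE adj_sym; congr orb; apply: eq_existsb => u.
by rewrite andbC [adj v u]adj_sym [adj u y]adj_sym.
Qed.

Lemma depends_on_saved v : depends_on (ball v) (fun w => saved w v).
Proof.
move=> w1 w2 ww; apply: eq_bigr => a _; congr (minn (_.-1) _).
apply: eq_card => z; rewrite !inE; case vz: (adj v z) => //=.
rewrite (ww z) ?inE ?vz//; congr (_ && _); apply: eq_forallb => y; congr (~~ _).
rewrite /beats; case zy: (adj z y) => //=.
rewrite (ww z) ?inE ?vz// (ww y)// inE; apply/orP; right; apply/existsP.
by exists z; rewrite vz.
Qed.

Lemma card_bigcup_le (I T : finType) (A : {set I}) (F : I -> {set T}) n :
  (forall i, i \in A -> #|F i| <= n)%N -> (#|\bigcup_(i in A) F i| <= #|A| * n)%N.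
Proof.
move=> Fn; apply: (@leq_trans (\sum_(i in A) #|F i|)); last first.
  by rewrite -sum_nat_const leq_sum.
elim/big_rec2: _ => [|i m B _ IH]; first by rewrite cards0.
by rewrite (leq_trans (leq_of_leqif (leq_card_setU _ _)))// leq_add2l.
Qed.

Lemma card_ball v : (#|ball v| <= r + r * r)%N.
Proof.
apply: (@leq_trans #|neighbors v :|: \bigcup_(u in neighbors v) neighbors u|).
  apply/subset_leq_card/fintype.subsetP => y; rewrite !inE.
  case/orP => [->//|/existsP[u /andP[vu uy]]]; apply/orP; right.
  by apply/bigcupP; exists u; rewrite inE.
rewrite (leq_trans (leq_of_leqif (leq_card_setU _ _)))// reg leq_add2l -{1}(reg v).
by apply: card_bigcup_le => u _; rewrite reg.
Qed.

Lemma card_near_ball v : (#|near ball v| <= (r + r * r) ^ 2)%N.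
Proof.
apply: (@leq_trans #|\bigcup_(y in ball v) ball y|).
  apply/subset_leq_card/fintype.subsetP => k; rewrite inE => /pred0Pn[y /andP[yv yk]].
  by apply/bigcupP; exists y => //; rewrite -ball_sym.
apply: leq_trans (card_bigcup_le (n := r + r * r) _) _ => [y _|]; first exact: card_ball.
by rewrite expnS expn1 leq_mul2r card_ball orbT.
Qed.

(** Markov's inequality for exp(-l [saved]). The bound on [l] matches the Lipschitz constant 4 in
    [mgf_le], and 32 is 2 times the 16 of [influence]. *)
Lemma pr_few_saved v (l eta : R) : 0 <= l <= 1 / 8 ->
  r%:R - C%:R + eta <= mean (fun w => (saved w v)%:R) ->
  pr R (fun w => ~~ (r < C + saved w v)%N) <=
  expR (32 * l ^+ 2 * (r%:R + C%:R^-1 * r%:R ^+ 2) - l * eta).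
Proof.
move=> /andP[l0 l1] meanS.
pose f w : R := (saved w v)%:R.
apply: (@le_trans _ _ (mean (fun w => expR (l * (r%:R - C%:R)) * expR (- l * f w)))).
  apply: le_mean => w; case: ltnP => /= [_|few]; first by rewrite mulr_ge0 ?expR_ge0.
  rewrite -expRD -[leLHS]expR0 ler_expR mulNr -mulrBr mulr_ge0// /f.
  by move: few; rewrite -(ler_nat R) natrD; lra.
have fO : depends_on [set x in enum G] f.
  by move=> w1 w2 ww; congr ((saved _ v)%:R); apply/ffunP => x; apply: ww; rewrite inE mem_enum.
have l4 : `|- l| * 4 <= 1 / 2 by rewrite normrN ger0_norm//; lra.
have := mgf_le (card_label G C0) l4 (enum_uniq G) fO (fun x _ => small_var_saved v x).
rewrite big_enum sum_influence meanZ => mgf.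
apply: (le_trans (ler_wpM2l (expR_ge0 _) mgf)).
rewrite -expRD ler_expR.
have := ler_wpM2l l0 meanS; rewrite -/f.
move: (mean f) (_ * r%:R ^+ 2) => m V; lra.
Qed.

Lemma colorable_of_mean (l eta : R) : (0 < r)%N -> 0 <= l <= 1 / 8 ->
  (forall v, r%:R - C%:R + eta <= mean (fun w => (saved w v)%:R)) ->
  4 * expR (32 * l ^+ 2 * (r%:R + C%:R^-1 * r%:R ^+ 2) - l * eta)
    * ((r + r * r) ^ 2)%:R <= 1 ->
  colorable G C.
Proof.
move=> r0 l01 meanS small.
have AS v : depends_on (ball v) (fun w => ~~ (r < C + saved w v)%N).
  by move=> w1 w2 ww; rewrite (depends_on_saved ww).
have pA v := pr_few_saved l01 (meanS v).
have [|w wP] := local_lemma (card_label G C0) AS pA card_near_ball small.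
  by rewrite expn_gt0 addn_gt0 r0.
apply: (@colorable_of_saved G C w) => v; rewrite reg.
by have := wP v; rewrite negbK.
Qed.

End Concentration.

(** * Asymptotics *)

Section Asymptotics.
Variable R : realType.

(** The derivative x(2a - 3bx) is nonnegative on [0, 1]; thus a neighbourhood sparser than required
    only helps. *)
Lemma cubic_mono (a b x y : R) : 0 <= b -> 3 * b <= 2 * a ->
  0 <= x -> x <= y -> y <= 1 -> a * x ^+ 2 - b * x ^+ 3 <= a * y ^+ 2 - b * y ^+ 3.
Proof.
move=> b0 ba x0 xy y1; rewrite -subr_ge0.
have -> : a * y ^+ 2 - b * y ^+ 3 - (a * x ^+ 2 - b * x ^+ 3) =
  (y - x) * (a * (x + y) - b * (x ^+ 2 + x * y + y ^+ 2)) by ring.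
rewrite mulr_ge0 ?subr_ge0//.
have : x ^+ 2 + x * y + y ^+ 2 <= 3 / 2 * (x + y) by nra.
move=> /(ler_wpM2l b0) /le_trans; apply.
rewrite mulrCA mulrA ler_wpM2r//; lra.
Qed.

Lemma mulr_expRN_le (t : R) : t * expR (- t) <= 1 / 2.
Proof.
have e2 : 2 <= expR (1 : R) by rewrite (le_trans _ (expR_ge1Dx 1))//; lra.
have : t <= expR t / expR 1.
  by rewrite -expRB (le_trans _ (expR_ge1Dx _))//; lra.
rewrite ler_pdivlMr ?expR_gt0// expRN ler_pdivrMr ?expR_gt0// => te.
have := expR_gt0 t; have [|] := leP 0 t; nra.
Qed.

(** The condition 3b <= 2a of [cubic_mono]. It amounts to t e^(t/8) <= 2, and here e^(t/8) <= 1/(1 -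
    t/8) <= 6/5. *)
Lemma coeff_ratio (t : R) : 1 <= t -> t <= 4 / 3 ->
  3 * (t ^+ 2 * expR (- (7 / 8 * t)) / 6) <= 2 * (t * expR (- t) / 2).
Proof.
move=> t1 t43.
have -> : expR (- (7 / 8 * t)) = expR (- t) * expR (t / 8).
  by rewrite -expRD; congr expR; field.
have x65 : expR (t / 8) <= 6 / 5.
  apply: (@le_trans _ _ (1 - t / 8)^-1).
    rewrite -[leLHS]invrK -expRN lef_pV2 ?posrE ?expR_gt0//; last by lra.
    by rewrite (le_trans _ (expR_ge1Dx _)).
  by rewrite -[leLHS]div1r ler_pdivrMr; lra.
have := expR_gt0 (- t); move: (expR (- t)) (expR _) x65 => e x x65 e0.
have tx : t * x <= 2 by nra.
have : e * t * (t * x) <= e * t * 2 by rewrite ler_wpM2l// mulr_ge0//; lra.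
lra.
Qed.

(** With u = c/2, 1/(1 - u) = 1 + u/(1 - u) <= exp(u/(1 - u)); invert and raise to the power 2r. *)
Lemma expRN_le_powr (c : R) (r : nat) : 0 < c < 1 -> (0 < r)%N ->
  expR (- (r%:R * c / (1 - c / 2))) <= (1 - c / 2) ^+ (2 * r).
Proof.
move=> /andP[c0 c1] r0.
have x0 : 0 < 1 - c / 2 by lra.
have -> : - (r%:R * c / (1 - c / 2)) = - (c / 2 / (1 - c / 2)) * (2 * r)%:R.
  by rewrite natrM; field; lra.
rewrite expRM_natr lerXn2r ?nnegrE ?expR_ge0//; first by lra.
rewrite expRN -[leRHS]invrK lef_pV2 ?posrE ?expR_gt0 ?invr_gt0//.
apply: le_trans (expR_ge1Dx _); rewrite le_eqVlt; apply/orP; left; apply/eqP.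
by field; lra.
Qed.

Lemma exp_beats_quartic (k : R) : 0 < k -> exists n0 : nat, forall n : nat,
  (n0 <= n)%N -> 4 * expR (- (k * n%:R)) * ((n + n * n) ^ 2)%:R <= 1.
Proof.
(* From e^(kn) >= (kn/5)^5, this [B] gives e^(kn) >= 16 n^4 for n >= [B], while 4 (n + n^2)^2 <= 16
   n^4. *)
move=> k0; pose B : R := 16 * (5 / k) ^+ 5.
exists (Num.bound B).+1 => n nB.
have n0 : (0 < n)%N by apply: leq_trans nB.
have n1 : 1 <= n%:R :> R by rewrite ler1n.
have Bn : B <= n%:R.
  have B0 : 0 <= B by rewrite mulr_ge0// exprn_ge0// divr_ge0// ltW.
  by rewrite ltW// (lt_le_trans (archi_boundP B0))// ler_nat ltnW.
have : (k * n%:R / 5) ^+ 5 <= expR (k * n%:R).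
  have -> : expR (k * n%:R) = expR (k * n%:R / 5) ^+ 5.
    by rewrite -expRM_natr; congr expR; field.
  have kn : 0 <= k * n%:R / 5 by rewrite divr_ge0// mulr_ge0// ltW.
  rewrite lerXn2r ?nnegrE ?expR_ge0// (le_trans _ (expR_ge1Dx _))//; lra.
move=> kE; rewrite expRN natrX natrD natrM mulrAC ler_pdivrMr ?expR_gt0// mul1r.
move: (n%:R) (expR _) n1 Bn kE => x E x1 Bx kE.
have k5 : 0 < (5 / k) ^+ 5 by rewrite exprn_gt0// divr_gt0.
have x4 : 16 * x ^+ 4 <= E.
  apply: le_trans kE.
  have -> : (k * x / 5) ^+ 5 = x * x ^+ 4 / (5 / k) ^+ 5 by field; lra.
  rewrite ler_pdivlMr// mulrAC ler_wpM2r// exprn_ge0//; lra.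
suff : (x + x * x) ^+ 2 <= 4 * x ^+ 4 by lra.
have -> : 4 * x ^+ 4 = (2 * x ^+ 2) ^+ 2 by ring.
rewrite lerXn2r ?nnegrE; nra.
Qed.

(** Here [x] is r, [y] is sqrt(N)/r and [h] = 8/r a relative error, which costs 3 (te) y^2 (hx) <= 3
    (1/2) 8 = 12. *)
Lemma pairs_term_ge (N c q t e h x y : R) : 1 <= t -> 0 < e -> t * e <= 1 / 2 ->
  0 < x -> h * x = 8 -> h <= 1 -> 0 <= y -> y <= 1 -> y ^+ 2 * x ^+ 2 = N ->
  t <= x * c -> e * (1 - h) <= q -> 3 * (t * e) * y ^+ 2 * x - 12 <= 3 * N * c * q.
Proof.
move=> t1 e0 te x0 hx h1 y0 y1 yN tu q_ge.
have y20 : 0 <= y ^+ 2 by exact: sqr_ge0.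
have y21 : y ^+ 2 <= 1 by exact: exprn_ile1.
have t0 : 0 <= t := le_trans ler01 t1.
have h1' : 0 <= 1 - h by rewrite subr_ge0.
have yx : 0 <= y ^+ 2 * x := mulr_ge0 y20 (ltW x0).
have Nc : y ^+ 2 * x * t <= N * c.
  have -> : N * c = y ^+ 2 * x * (x * c) by rewrite -yN; ring.
  by rewrite ler_wpM2l.
have P1 : y ^+ 2 * x * t * (e * (1 - h)) <= N * c * q.
  exact: ler_pM (mulr_ge0 yx t0) (mulr_ge0 (ltW e0) h1') Nc q_ge.
have P2 : y ^+ 2 * x * t * (e * (1 - h)) =
  (t * e) * y ^+ 2 * x - (t * e) * y ^+ 2 * (h * x) by ring.
rewrite P2 hx in P1.
have P3 : t * e * y ^+ 2 <= 1 / 2 * 1 by exact: ler_pM (mulr_ge0 t0 (ltW e0)) y20 te y21.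
by clear -P1 P3; lra.
Qed.

(** Expanding x (t + h)^2 with hx = 8 leaves the error 16t + 8h <= 30. *)
Lemma triples_term_le (T c E t e h x y : R) : 0 <= t -> t <= 4 / 3 ->
  0 < e -> e <= 1 -> 0 <= E -> E <= e -> 0 <= h -> h <= 1 -> 0 < x -> h * x = 8 ->
  0 <= y -> y <= 1 -> 0 <= T -> T <= y ^+ 3 * x ^+ 3 -> 0 <= c -> x * c <= t + h ->
  T * c ^+ 2 * E <= t ^+ 2 * e * y ^+ 3 * x + 30.
Proof.
move=> t0 t43 e0 e1 E0 Ee h0 h1 x0 hx y0 y1 T0 Ty c0 u.
have y30 : 0 <= y ^+ 3 by exact: exprn_ge0.
have y31 : y ^+ 3 <= 1 by exact: exprn_ile1.
have xc0 : 0 <= x * c := mulr_ge0 (ltW x0) c0.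
have u2 : x * (x * c) ^+ 2 <= x * t ^+ 2 + 30.
  have : (x * c) ^+ 2 <= (t + h) ^+ 2 by rewrite lerXn2r ?nnegrE// addr_ge0.
  move=> /(ler_wpM2l (ltW x0)) /le_trans; apply.
  have -> : x * (t + h) ^+ 2 = x * t ^+ 2 + 2 * t * (h * x) + h * (h * x) by ring.
  by rewrite hx; clear -t43 h1; lra.
have Tc : T * c ^+ 2 <= y ^+ 3 * (x * (x * c) ^+ 2).
  have -> : y ^+ 3 * (x * (x * c) ^+ 2) = y ^+ 3 * x ^+ 3 * c ^+ 2 by ring.
  by rewrite ler_wpM2r// exprn_ge0.
have Tc0 : 0 <= T * c ^+ 2 by rewrite mulr_ge0// exprn_ge0.
apply: (le_trans (ler_pM Tc0 E0 Tc Ee)).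
apply: (@le_trans _ _ (y ^+ 3 * (x * t ^+ 2 + 30) * e)).
  by rewrite ler_wpM2r ?(ltW e0)// ler_wpM2l.
have : y ^+ 3 * e <= 1 * 1 by exact: ler_pM y30 (ltW e0) y31 e1.
by clear; lra.
Qed.

(** Pairs number r(r-1) and not r^2, so [y] may fall slightly below [s]; the loss is then at most a
    s^2 <= a. *)
Lemma cubic_mono_approx (a b x s y N : R) : 0 <= a -> 0 <= b -> 3 * b <= 2 * a ->
  0 < x -> 0 <= s -> s <= 1 -> 0 <= y -> y <= 1 -> y ^+ 2 * x ^+ 2 = N ->
  s ^+ 2 * (x * (x - 1)) <= N ->
  x * (a * s ^+ 2 - b * s ^+ 3) - a <= x * (a * y ^+ 2 - b * y ^+ 3).
Proof.
move=> a0 b0 ba x0 s0 s1 y0 y1 yN sN.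
have [sy|ys] := leP s y.
  have := ler_wpM2l (ltW x0) (cubic_mono b0 ba s0 sy y1).
  by clear -a0; lra.
have y2 : s ^+ 2 * (x - 1) <= y ^+ 2 * x.
  rewrite -(ler_pM2r x0) -mulrA [leRHS](_ : _ = N); last by rewrite -yN; ring.
  by rewrite [(x - 1) * x]mulrC.
have y3 : y ^+ 3 <= s ^+ 3 by rewrite lerXn2r ?nnegrE// ltW.
have := ler_wpM2l a0 y2; have := ler_wpM2l (mulr_ge0 (ltW x0) b0) y3.
have : a * s ^+ 2 <= a * 1 by rewrite ler_wpM2l// exprn_ile1.
by clear; lra.
Qed.

Lemma mean_saved_asymptotic (G : sgraph) (C r : nat) (t s : R) (v : G) :
  (forall x : G, #|neighbors x| = r) ->
  1 <= t -> t <= 4 / 3 -> 0 <= s -> s <= 1 -> (8 <= r)%N ->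
  t * C%:R <= r%:R -> r%:R < t * C.+1%:R ->
  (link v)%:R <= (1 - s ^+ 2) * (r%:R * r.-1%:R) ->
  r%:R * (t * expR (- t) / 2 * s ^+ 2
          - t ^+ 2 * expR (- (7 / 8 * t)) / 6 * s ^+ 3) - 8 <=
  mean (fun w : {ffun G -> label G C} => (saved w v)%:R).
Proof.
move=> reg t1 t43 s0 s1 r8 Cr rC lv.
have r8' : 8 <= r%:R :> R by rewrite (ler_nat R 8).
have Ct : r%:R < t * C%:R + t by move: rC; rewrite -natr1 mulrDr mulr1.
have C2 : 5 <= C%:R :> R by have : 0 <= C%:R :> R by []; nra.
have C0 : (0 < C)%N by rewrite -(ltr0n R); lra.
have := mean_saved_ge R C0 reg v.
set S := mean _.
have Npl := npairs_link reg v.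
have NT : (ntriples v)%:R ^+ 2 <= (npairs v)%:R ^+ 3 :> R.
  by rewrite -!natrX ler_nat; exact: (ntriples_npairs R).
have Nr : (npairs v)%:R + (link v)%:R = r%:R * (r%:R - 1) :> R.
  by rewrite -natrD Npl natrM -subn1 natrB//; apply: leq_trans r8.
have lv' : (link v)%:R <= (1 - s ^+ 2) * (r%:R * (r%:R - 1)) :> R.
  by move: lv; rewrite -subn1 natrB//; apply: leq_trans r8.
have l0 : 0 <= (link v)%:R :> R by [].
have Cc : C%:R * C%:R^-1 = 1 :> R by rewrite mulfV//; lra.
have c0 : 0 < C%:R^-1 :> R by rewrite invr_gt0; lra.
have q_ge := @expRN_le_powr C%:R^-1 r.
have N0 : 0 <= (npairs v)%:R :> R by [].
have T0 : 0 <= (ntriples v)%:R :> R by [].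
have te := mulr_expRN_le t.
have e10 : 0 < expR (- t) by exact: expR_gt0.
have e20 : 0 < expR (- (7 / 8 * t)) by exact: expR_gt0.
have e21 : expR (- (7 / 8 * t)) <= 1 by rewrite -[leRHS]expR0 ler_expR; lra.
have ratio := coeff_ratio t1 t43.
have rgt0 : (0 < r)%N by apply: leq_trans r8.
move: q_ge Nr lv' l0 Cc c0 N0 T0 NT r8' Cr Ct C2.
move: (npairs v)%:R (ntriples v)%:R (link v)%:R (C%:R) (C%:R^-1) => N T L D c.
move=> q_ge Nr lv' l0 Dc c0 N0 T0 NT r8' Dr Dt D2.
have c15 : c <= 1 / 5 by nra.
have x0 : 0 < 1 - c / 2 by lra.
have c01 : 0 < c < 1 by apply/andP; split; lra.
have {}q_ge := q_ge c01 rgt0.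
(* This absorbs both the rounding of [C] and the correction 1/(1 - c/2) in the exponent. *)
pose h : R := 8 / r%:R.
have hr : h * r%:R = 8 by rewrite /h mulfVK//; lra.
have h0 : 0 < h by rewrite divr_gt0//; lra.
have h1 : h <= 1 by nra.
have sig : r%:R * c / (1 - c / 2) <= t + h.
  rewrite ler_pdivrMr//.
  have -> : (t + h) * (1 - c / 2) = (t + h) * (D - 1 / 2) * c.
    by rewrite -mulrA [(D - _) * c]mulrBl Dc; field.
  rewrite ler_wpM2r ?ltW//.
  have rD : 3 * r%:R - 4 <= 4 * D by nra.
  have hD : 6 - h <= h * D.
    have := ler_wpM2l (ltW h0) rD; lra.
  nra.
have tu : t <= r%:R * c by have := ler_wpM2r (ltW c0) Dr; rewrite -mulrA Dc mulr1.
have E_le : expR (- (7 / 8 * r%:R * c)) <= expR (- (7 / 8 * t)).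
  by rewrite ler_expR lerN2; lra.
have q_ge' : expR (- t) * (1 - h) <= (1 - c / 2) ^+ (2 * r).
  apply: le_trans q_ge.
  apply: (@le_trans _ _ (expR (- t - h))); last by rewrite ler_expR; lra.
  by rewrite expRD ler_pM2l// expR_ge1Dx.
pose y := Num.sqrt N / r%:R.
have y0 : 0 <= y by rewrite divr_ge0 ?sqrtr_ge0//; lra.
have yN : y ^+ 2 * r%:R ^+ 2 = N.
  by rewrite -exprMn mulfVK ?sqr_sqrtr//; lra.
have y1 : y <= 1.
  have : y ^+ 2 * r%:R ^+ 2 <= 1 * r%:R ^+ 2 by rewrite yN; nra.
  by rewrite ler_pM2r ?exprn_gt0 ?ltr0n// -[leRHS](expr1n _ 2%N) ler_pXn2r ?nnegrE.
have Ty : T <= y ^+ 3 * r%:R ^+ 3.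
  rewrite -(@ler_pXn2r _ 2%N) ?nnegrE//; last by rewrite mulr_ge0// exprn_ge0//; lra.
  apply: le_trans NT _; rewrite -yN le_eqVlt; apply/orP; left; apply/eqP; ring.
move: (_ ^+ (2 * r)) q_ge' => q q_ge'.
move: (expR (- (7 / 8 * r%:R * c))) (expR_ge0 (- (7 / 8 * r%:R * c))) E_le => E E0 E_le.
move: (expR (- (7 / 8 * t))) (expR (- t)) e20 e21 e10 te ratio q_ge' E_le {q_ge}.
move: (r%:R) hr r8' Nr lv' Dr Dt sig tu yN Ty => x hx x8 Nr lv' Dr Dt sig tu yN Ty.
move=> e2 e1 e20 e21 e10 te ratio q_ge E_le {rC lv}.
have x0' : 0 < x by lra.
have t0 : 0 <= t by lra.
have u : x * c <= t + h.
  by move: sig; rewrite ler_pdivrMr// => /le_trans; apply; nra.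
have sN : s ^+ 2 * (x * (x - 1)) <= N by lra.
have pairs := pairs_term_ge t1 e10 te x0' hx h1 y0 y1 yN tu q_ge.
have triples := triples_term_le t0 t43 e20 e21 E0 E_le (ltW h0) h1 x0' hx y0 y1 T0 Ty (ltW c0) u.
pose a := t * e1 / 2.
pose b := t ^+ 2 * e2 / 6.
have b0 : 0 <= b by rewrite divr_ge0// mulr_ge0 ?exprn_ge0 ?(ltW e20).
have a0 : 0 <= a by rewrite divr_ge0// mulr_ge0// ltW.
have mono := cubic_mono_approx a0 b0 ratio x0' s0 s1 y0 y1 yN sN.
(* Error budget: (12 + 30)/6 from pairs and triples plus a <= 1/4, below the announced 8. *)
move=> main.
have : 6 * (x * (a * y ^+ 2 - b * y ^+ 3)) = 3 * (t * e1) * y ^+ 2 * x - t ^+ 2 * e2 * y ^+ 3 * x.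
  by rewrite /a /b; field.
have a1 : a <= 1 / 4 by rewrite /a; lra.
move: mono a1 pairs triples main; rewrite -/a -/b; clear; lra.
Qed.

End Asymptotics.

(** * Choice of the parameters and conclusion *)

Theorem lemma5 (R : realType) (gamma delta : R)
    (hgamma : 0 < gamma < 1) (hdelta : 0 < delta < 1)
    (h : gamma < delta / (2 * (1 - gamma)) * expR (- (1 / (1 - gamma)))
                 - delta `^ (3 / 2) / (6 * (1 - gamma) ^+ 2)
                   * expR (- (7 / (8 * (1 - gamma))))) :
  exists r0 : nat, forall r : nat, (r0 <= r)%N ->
    forall G : sgraph,
      (max_degree G <= r)%N ->
      (forall v : G, #|edges (induced_subgraph (neighbors v))|%:R
                       <= (1 - delta) * 'C(r, 2)%:R) ->
      (chromatic_number G)%:R <= (1 - gamma) * r%:R.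
Proof.
have /andP[g0 g1] := hgamma; have /andP[d0 d1] := hdelta.
pose t := (1 - gamma)^-1; pose s := Num.sqrt delta.
have t0 : 0 < t by rewrite invr_gt0; lra.
have tg : t * (1 - gamma) = 1 by rewrite mulVf//; lra.
have s2 : s ^+ 2 = delta by rewrite sqr_sqrtr// ltW.
have s0 : 0 <= s by exact: sqrtr_ge0.
have s1 : s <= 1 by nra.
have s3 : delta `^ (3 / 2) = s ^+ 3.
  have -> : 3 / 2 = 2^-1 * 3%:R :> R by field.
  by rewrite powRrM powR12_sqrt ?ltW// powR_mulrn.
pose a := t * expR (- t) / 2.
pose b := t ^+ 2 * expR (- (7 / 8 * t)) / 6.
have {}h : gamma < a * s ^+ 2 - b * s ^+ 3.
  move: h; rewrite s3 -s2 div1r -/t.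
  have -> : 7 / (8 * (1 - gamma)) = 7 / 8 * t by rewrite /t; field; lra.
  have -> : s ^+ 2 / (2 * (1 - gamma)) * expR (- t) = a * s ^+ 2.
    by rewrite /a /t; field; lra.
  suff -> : s ^+ 3 / (6 * (1 - gamma) ^+ 2) * expR (- (7 / 8 * t)) = b * s ^+ 3 by [].
  by rewrite /b /t; field; lra.
have b0 : 0 < b by rewrite divr_gt0// mulr_gt0 ?expR_gt0 ?exprn_gt0.
have a14 : a <= 1 / 4 by have := mulr_expRN_le t; rewrite /a; lra.
have a0 : 0 < a by rewrite divr_gt0// mulr_gt0// expR_gt0.
have s30 : 0 <= s ^+ 3 by exact: exprn_ge0.
have as2 : a * s ^+ 2 <= a * 1 by rewrite ler_wpM2l ?(ltW a0)// exprn_ile1.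
have bs3 := mulr_ge0 (ltW b0) s30.
(* The hypothesis itself forces this, through t e^(-t) <= 1/2, and with it t <= 4/3. *)
have g14 : gamma < 1 / 4 by lra.
have t1 : 1 <= t by nra.
have t43 : t <= 4 / 3 by nra.
pose eps := a * s ^+ 2 - b * s ^+ 3 - gamma.
have eps0 : 0 < eps by rewrite /eps; lra.
have eps1 : eps <= 1 by rewrite /eps; lra.
have k0 : 0 < (eps / 16) ^+ 2 / 8 by rewrite divr_gt0// exprn_gt0// divr_gt0.
have [n0 n0P] := exp_beats_quartic k0.
(* 8 serves the asymptotic estimates, [n0] the local lemma, and eps r >= 20 lets eps r / 2 absorb
   the error 8 and the rounding of [C]. *)
exists (maxn 8 (maxn n0 (Num.bound (20 / eps)))) => r.
rewrite !geq_max => /and3P[r8 rn0 rb] G dG eG.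
have r8' : 8 <= r%:R :> R by rewrite (ler_nat R 8).
have reps : 20 <= eps * r%:R.
  have B0 : 0 <= 20 / eps by rewrite divr_ge0// ltW.
  rewrite mulrC -ler_pdivrMr// ltW// (lt_le_trans (archi_boundP B0))//.
  by rewrite ler_nat.
pose C := Num.truncn ((1 - gamma) * r%:R).
have gr0 : 0 <= (1 - gamma) * r%:R by rewrite mulr_ge0//; lra.
have Cle : C%:R <= (1 - gamma) * r%:R by rewrite truncn_le.
have Clt : (1 - gamma) * r%:R < C.+1%:R by exact: truncnS_gt.
suff colG : colorable G C.
  apply: le_trans Cle; rewrite ler_nat /chromatic_number.
  by case: ex_minnP => k _; exact.
have rr1 : 0 <= (1 - delta) * (r%:R * r.-1%:R).
  by rewrite !mulr_ge0//; lra.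
pose m := Num.truncn ((1 - delta) * (r%:R * r.-1%:R)).
have degG (v : G) : (#|neighbors v| <= r)%N.
  by apply: leq_trans dG; exact: (leq_bigmax v).
have linkG (v : G) : (link v <= m)%N.
  rewrite truncn_ge_nat//.
  apply: (@le_trans _ _ (2 * #|edges (induced_subgraph (neighbors v))|%:R)).
    by rewrite -natrM ler_nat link_le_edges.
  have /(ler_wpM2l (ler0n R 2)) /le_trans := eG v; apply.
  rewrite mulrCA ler_wpM2l//; first by lra.
  by rewrite -!natrM ler_nat bin2 mul2n halfK leq_subr.
have [H [degH linkH]] := regularize C degG linkG; apply.
have tC : t * C%:R <= r%:R.
  by have := ler_wpM2l (ltW t0) Cle; rewrite mulrA tg mul1r.
have rC : r%:R < t * C.+1%:R.
  by move: Clt; rewrite -(ltr_pM2l t0) mulrA tg mul1r.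
have C5 : 5 <= C%:R :> R by move: Clt; rewrite -natr1; nra.
have C0 : (0 < C)%N by rewrite -(ltr0n R); lra.
have c0 : 0 < C%:R^-1 :> R by rewrite invr_gt0; lra.
have cr : C%:R^-1 * r%:R <= 3 :> R.
  rewrite mulrC ler_pdivrMr ?ltr0n//; move: Clt; rewrite -natr1; nra.
(* Since r + r^2/C <= 4r, the exponent 128 l^2 r - l eps r / 2 at l = eps/512 is -eps^2 r / 2048,
   the rate for which [n0] was chosen. *)
apply: (@colorable_of_mean R H C r C0 degH (eps / 16 / 32) (eps / 2 * r%:R)).
- by apply: leq_trans r8.
- by apply/andP; split; lra.
- move=> v; apply: le_trans (mean_saved_asymptotic degH t1 t43 s0 s1 r8 tC rC _); last first.
    by rewrite s2 (le_trans _ (_ : m%:R <= _)) ?ler_nat ?truncn_le.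
  rewrite -/a -/b; move: Clt; rewrite -natr1 => Clt.
  have -> : a * s ^+ 2 - b * s ^+ 3 = eps + gamma by rewrite /eps; ring.
  lra.
- apply: le_trans (n0P r rn0).
  rewrite ler_wpM2r// ler_wpM2l// ler_expR.
  set V := r%:R + _.
  have r2 : V <= 4 * r%:R.
    by have := ler_wpM2r (ler0n R r) cr; rewrite -mulrA -expr2 /V; lra.
  have := ler_wpM2l (sqr_ge0 eps) r2.
  by move: {r2} (V) (r%:R) (eps) => W x e; lra.
Qed.
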